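(* For every fixed integer $k \ge 4$, the problem \textsc{$k$-Mixing} is co-NP-hard. Moreover, it remains co-NP-hard when restricted to input graphs $G$ that admit a proper $(k-1)$-coloring in which all color classes except at most $2$ consist of a single vertex.
   Context: All graphs are finite and simple, and all colorings are proper (adjacent vertices receive distinct colors). A $k$-coloring of $G$ is a proper coloring of $G$ with colors from a fixed set of $k$ colors. Two $k$-colorings of $G$ are adjacent if they differ on exactly one vertex. For a $k$-colorable graph $G$, the configuration graph of the $k$-colorings of $G$ is the graph whose vertices are the $k$-colorings of $G$, with the adjacency just defined. A $k$-colorable graph $G$ is $k$-mixing if this configuration graph is connected, i.e., any $k$-coloring of $G$ can be transformed into any other by a sequence of single-vertex recolorings such that every intermediate coloring is a proper $k$-coloring. The problem \textsc{$k$-Mixing} (for fixed $k$) takes as input a $k$-colorable graph $G$ and asks whether $G$ is $k$-mixing. *)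

(* Defs.v *)
From HB Require Import structures.
From mathcomp Require Import all_boot all_order all_algebra.
Set Implicit Arguments.
Unset Strict Implicit.
Unset Printing Implicit Defensive.

Record graph := Graph {
  vertex :> finType;
  adj : rel vertex;
  adj_sym : symmetric adj;
  adj_irr : irreflexive adj
}.

Definition connected (G : graph) : Prop := forall x y : G, connect (@adj G) x y.

Section Colorings.
Variables (k : nat) (G : graph).

Definition proper (c : {ffun G -> 'I_k}) : bool :=
  [forall x, forall y, adj x y ==> (c x != c y)].

Definition coloring : finType := {c : {ffun G -> 'I_k} | proper c}.

Definition colorable : Prop := exists c : {ffun G -> 'I_k}, proper c.

Definition recolor : rel coloring :=
  fun c d => #|[set x | sval c x != sval d x]| == 1.

Fact recolor_sym : symmetric recolor.
Proof.
move=> c d; rewrite /recolor; congr (_ == _); apply: eq_card => x.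
by rewrite !inE eq_sym.
Qed.

Fact recolor_irr : irreflexive recolor.
Proof.
move=> c; rewrite /recolor (_ : [set x | _] = set0) ?cards0 //.
by apply/setP=> x; rewrite !inE eqxx.
Qed.

Definition configuration_graph : graph :=
  Graph recolor_sym recolor_irr.

Definition k_mixing : Prop := connected configuration_graph.

Definition color_class (c : {ffun G -> 'I_k}) (i : 'I_k) : {set G} :=
  [set x | c x == i].

End Colorings.

(* A color that is not used counts among the exceptional classes. *)
Definition singletons_but_two (m : nat) (G : graph) : Prop :=
  exists c : {ffun G -> 'I_m},
    proper c /\ #|[set i | #|color_class c i| != 1]| <= 2.

Definition word := seq bool.

Inductive move := Lft | Stay | Rgt.

(* [None] is the blank; the bits are available to every machine, in addition
   to its own finite set of work symbols. *)
Definition cell (work : finType) : finType := option (bool + work)%type.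

(* There are [extra_tapes.+1] tapes; [None] as a transition means halting. *)
Record machine := Machine {
  extra_tapes : nat;
  state : finType;
  work : finType;
  start : state;
  trans : state -> {ffun 'I_extra_tapes.+1 -> cell work} ->
          option (state * {ffun 'I_extra_tapes.+1 -> cell work} *
                  ('I_extra_tapes.+1 -> move))
}.

Definition moved (m : move) (h : int) : int :=
  match m with Lft => h - 1 | Stay => h | Rgt => h + 1 end%R.

Definition word_tape (work : finType) (x : word) (p : int) : cell work :=
  match p with
  | Posz n => omap inl (onth x n)
  | Negz _ => None
  end.

Section Run.
Variable M : machine.

Record config := Config {
  cstate : state M;
  head : 'I_(extra_tapes M).+1 -> int;
  tape : 'I_(extra_tapes M).+1 -> int -> cell (work M)
}.

Definition next (c : config) :=
  trans (cstate c) [ffun j => tape c j (head c j)].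

Definition halted (c : config) : Prop := next c = None.

Definition step (c : config) : config :=
  if next c is Some (q, w, m) then
    Config q (fun j => moved (m j) (head c j))
      (fun j p => if p == head c j then w j else tape c j p)
  else c.

Definition initial (x : word) : config :=
  Config (start M) (fun _ => 0%R)
    (fun j p => if j == ord0 then word_tape (work M) x p else None).

Definition run (x : word) (t : nat) : config := iter t step (initial x).

(* The input is given on the first tape, the output is read off the last one;
   they coincide for a one-tape machine. *)
Definition outputs_within (x y : word) (t : nat) : Prop :=
  halted (run x t) /\
  forall p : int, tape (run x t) ord_max p = word_tape (work M) y p.

End Run.

Definition poly_time (f : word -> word) : Prop :=
  exists (M : machine) (p : {poly nat}),
    forall x, outputs_within M x (f x) p.[size x]%R.

Definition language := word -> Prop.

(* A self-delimiting encoding of pairs of words. *)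
Definition pair_word (x w : word) : word :=
  flatten [seq [:: true; b] | b <- x] ++ false :: w.

Definition NP (L : language) : Prop :=
  exists (V : word -> word) (p : {poly nat}),
    poly_time V /\
    forall x, L x <->
      exists w, size w <= p.[size x]%R /\ V (pair_word x w) = [:: true].

Definition coNP (L : language) : Prop := NP (fun x => ~ L x).

(* A decision problem comes with its own set of admissible inputs, so that a
   reduction has to produce admissible inputs only. *)
Record problem := Problem {
  instance : Type;
  encode : instance -> word;
  yes : instance -> Prop
}.

Definition restrict (P : problem) (A : instance P -> Prop) : problem :=
  @Problem {I : instance P | A I}
    (fun I => encode (proj1_sig I)) (fun I => yes (proj1_sig I)).

Definition reduces_to (L : language) (P : problem) : Prop :=
  exists g : word -> instance P,
    poly_time (fun x => encode (g x)) /\ forall x, L x <-> yes (g x).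

Definition coNP_hard (P : problem) : Prop :=
  forall L, coNP L -> reduces_to L P.

(* The number of vertices in unary, then the adjacency matrix row by row. *)
Definition encode_graph (G : graph) : word :=
  nseq #|G| true ++ false :: [seq adj x y | x <- enum G, y <- enum G].

Definition Mixing (k : nat) : problem :=
  @Problem {G : graph | colorable k G}
    (fun G => encode_graph (proj1_sig G)) (fun G => k_mixing k (proj1_sig G)).

(* Main.v *)
(* For a finite set U, the long code of U has as vertices two copies of the functions from U
   to {0,1,2}, functions in opposite copies being adjacent when they differ everywhere. Its
   proper 3-colourings are of two sorts. If opposite copies of each constant function have
   the same colour then, up to a permutation of the colours, the colouring is governed by a
   dictator d in U: an ultrafilter argument. Otherwise it lifts to an integer height function
   changing by one along every edge: the weights of colour steps cancel around 4-cycles, so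
   that the weight of a closed walk depends only on the multiset of its directions, and the
   loops in a single direction all have weight zero.

   The reduction attaches a long code to each window of the tableau of a nondeterministic
   computation, U being the set of locally correct contents of the window. All long codes
   share their constant functions, which form a hexagon, and link vertices force the
   dictators of overlapping windows to agree. Adding k - 3 dominating vertices brings
   k-colourings down to 3-colourings of the rest. If an accepting computation exists, the
   dictators it gives define a colouring whose hexagon and dominating vertices can never be
   recoloured, so that the graph is not k-mixing. Otherwise no colouring gives the hexagon a
   dictatorial colouring, so there always is a height function; lowering its maxima and
   raising its minima by two leads to a colouring of a complete (k-1)-partite pattern, and
   those are connected to each other because one colour is spare. *)
Require Import Defs.
From Stdlib Require Import FunctionalExtensionality Classical.
From mathcomp Require Import all_boot all_order all_algebra.
From mathcomp Require Import zify ring.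
Set Implicit Arguments.
Unset Strict Implicit.
Unset Printing Implicit Defensive.
Import GRing.Theory Defs.

(** * Three-colourings of long codes *)

Section ColorSteps.
Local Open Scope ring_scope.

Definition colstep (a b : 'I_3) : int := if b == a + 1 then 1 else -1.

Lemma ord3P (P : 'I_3 -> Prop) : P 0 -> P 1 -> P 2 -> forall a, P a.
Proof.
move=> P0 P1 P2 [[|[|[|//]]] lta].
- by rewrite (_ : Ordinal _ = 0) //; apply: val_inj.
- by rewrite (_ : Ordinal _ = 1) //; apply: val_inj.
- by rewrite (_ : Ordinal _ = 2) //; apply: val_inj.
Qed.

(** The four signed weights around a closed 4-cycle of colours sum to a multiple of 3 that is even
    and at most 4 in absolute value, hence to 0. *)
Lemma colstep3 a b c d : a != b -> b != c -> c != d -> a != d ->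
  colstep a b + colstep b c + colstep c d = colstep a d.
Proof. by move: a b c d; do 4 (apply: ord3P). Qed.

Lemma colstepC a b : a != b -> colstep b a = - colstep a b.
Proof. by move: a b; do 2 (apply: ord3P). Qed.

Lemma colstep_mod3 (a b : 'Z_3) : a != b -> (colstep a b)%:~R = b - a :> 'Z_3.
Proof. by move=> ab; apply/eqP; move: a b ab; do 2 (apply: ord3P). Qed.

Lemma colstep_pm a b : colstep a b = 1 \/ colstep a b = -1.
Proof. by rewrite /colstep; case: ifP; [left|right]. Qed.

End ColorSteps.

(* The long code over [U] has two copies of ['I_3 ^ D], and functions in opposite copies
   are adjacent when they differ everywhere on [U]; [F b] colours the copy [b]. *)
Section LongCode.
Local Open Scope ring_scope.
Variables (D : finType) (U : {set D}) (F : bool -> {ffun D -> 'I_3} -> 'I_3).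
Implicit Types (b : bool) (f g e : {ffun D -> 'I_3}) (s t : seq {ffun D -> 'I_3}).

Definition differ f g := forall d, d \in U -> f d != g d.

Hypothesis F_proper : forall b f g, differ f g -> F b f != F (~~ b) g.

Definition unitstep : pred {ffun D -> 'I_3} := fun e => [forall d in U, e d != 0].

Lemma unitstep_differ f e : unitstep e -> differ f (f + e).
Proof.
move=> /forallP ue d dU; have /implyP/(_ dU) := ue d.
by rewrite ffunE -{1}[f d]addr0 (inj_eq (addrI _)) eq_sym.
Qed.

Lemma differ_unitstep f g : differ f g -> unitstep (g - f).
Proof.
move=> dfg; apply/forallP=> d; apply/implyP=> /dfg.
by rewrite !ffunE subr_eq0 eq_sym.
Qed.

Fixpoint walk b f s : int :=
  if s is e :: s' then colstep (F b f) (F (~~ b) (f + e)) + walk (~~ b) (f + e) s'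
  else 0.

Lemma walk_cat b f s t :
  walk b f (s ++ t) =
  walk b f s + walk (b (+) odd (size s)) (f + \sum_(e <- s) e) t.
Proof.
elim: s b f => [|e s IH] b f /=; first by rewrite big_nil addr0 addbF add0r.
by rewrite IH big_cons !addrA addNb addbN.
Qed.

(** Exchanging two consecutive steps replaces one half of a 4-cycle by the other half, which has the
    same weight by [colstep3]. *)
Lemma walk_cons_cat b f e s t : unitstep e -> all unitstep s ->
  walk b f (e :: s ++ t) = walk b f (s ++ e :: t).
Proof.
move=> ue; elim: s b f => [//|e' s IH] b f /= /andP[ue' us].
rewrite -IH //= addrA [RHS]addrA (addrAC f e e'); congr (_ + _).
have h1 := F_proper b (unitstep_differ f ue).
have h2 := F_proper b (unitstep_differ f ue').
have h3 := F_proper (~~ b) (unitstep_differ (f + e) ue').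
have h4 := F_proper (~~ b) (unitstep_differ (f + e') ue).
rewrite (addrAC f e e') in h3 *.
rewrite -(@colstep3 _ _ _ _ h2 h4 _ h1); last by rewrite eq_sym.
by rewrite (colstepC h3); ring.
Qed.

Lemma walk_perm b f s t : all unitstep s -> perm_eq s t -> walk b f s = walk b f t.
Proof.
elim: s t b f => [|e s IH] t b f /=.
  by move=> _; rewrite perm_sym => /perm_nilP ->.
move=> /andP[ue us] est.
have et : e \in t by rewrite -(perm_mem est) mem_head.
case/splitPr: et est => t1 t2; rewrite perm_sym -cat1s perm_catCA /= perm_cons.
move=> est; rewrite -walk_cons_cat //=; first by rewrite (IH (t1 ++ t2)) // perm_sym.
by move: us; rewrite -(perm_all _ est) all_cat => /andP[].
Qed.

Lemma reach b f b' g :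
  exists s, [/\ all unitstep s, \sum_(e <- s) e = g - f & odd (size s) = b (+) b'].
Proof.
(* Every residue [c] is the sum of two nonzero ones, [m c] and [c - m c], so two steps reach any
   function; the constant step 1 adjusts the parity. *)
pose m (c : 'I_3) : 'I_3 := if c == 1 then 2 else 1.
have m0 c : m c != 0 by move: c; apply: ord3P.
have m1 c : c - m c != 0 by move: c; apply: ord3P.
have even_reach h : exists s, [/\ all unitstep s, \sum_(e <- s) e = h & odd (size s) = false].
  exists [:: [ffun d => m (h d)]; [ffun d => h d - m (h d)]]; split=> //.
    by rewrite /= andbT; apply/andP; split; apply/forallP=> d; apply/implyP=> _; rewrite ffunE.
  by rewrite !big_cons big_nil addr0; apply/ffunP=> d; rewrite !ffunE addrC subrK.
case: (altP (b =P b')) => [->|neb].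
  by have [s [us es os]] := even_reach (g - f); exists s; rewrite addbb.
have [s [us es os]] := even_reach (g - f - [ffun=> 1]); exists ([ffun=> 1] :: s); split.
- by rewrite /= us andbT; apply/forallP=> d; apply/implyP=> _; rewrite ffunE.
- by rewrite big_cons es addrC subrK.
- by rewrite /= os; case: b b' neb => [] [].
Qed.

Section Unwound.
Variables (b0 : bool) (f0 : {ffun D -> 'I_3}).
Hypothesis unwound : F b0 f0 != F (~~ b0) f0.

Lemma triple e : e + e + e = 0.
Proof. by apply/ffunP=> d; rewrite !ffunE; move: (e d); apply: ord3P; apply/eqP. Qed.

(* Steps commute, so the weight of a six-fold loop does not depend on its base point. At
   [f0] its two halves run between the distinct colours of the two copies of [f0], hence
   cancel, three colour steps between distinct colours having the weight of a single one. *)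
Lemma walk_loop b f e : unitstep e -> walk b f (nseq 6 e) = 0.
Proof.
move=> ue.
have loop0 : walk b0 f0 (nseq 6 e) = 0.
  have half b' (ub : F b' f0 != F (~~ b') f0) :
      walk b' f0 (nseq 3 e) = colstep (F b' f0) (F (~~ b') f0).
    have h1 := F_proper b' (unitstep_differ f0 ue).
    have h2 := F_proper (~~ b') (unitstep_differ (f0 + e) ue).
    have h3 := F_proper b' (unitstep_differ (f0 + e + e) ue).
    rewrite negbK in h2.
    have e3 : f0 + e + e + e = f0 by rewrite -!addrA (addrA e) triple addr0.
    by rewrite /= negbK e3 in h3 *; rewrite addr0 addrA colstep3.
  rewrite (_ : nseq 6 e = nseq 3 e ++ nseq 3 e) // walk_cat half //.
  rewrite (_ : \sum_(e' <- _) e' = 0); last by rewrite !big_cons big_nil addr0 addrA triple.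
  rewrite addr0 addbT half; first by rewrite negbK [X in _ + X]colstepC // subrr.
  by rewrite negbK eq_sym.
have [s [us es os]] := reach b0 f0 b f.
have -> : b = b0 (+) odd (size s) by rewrite os addbA addbb.
have -> : f = f0 + \sum_(e <- s) e by rewrite es addrC subrK.
have := @walk_perm b0 f0 (s ++ nseq 6 e) (nseq 6 e ++ s).
rewrite all_cat us all_nseq ue orbT perm_catC !walk_cat loop0 => /(_ isT (perm_refl _)).
have -> : f0 + \sum_(e' <- nseq 6 e) e' = f0.
  rewrite !big_cons big_nil -[RHS]addr0; congr (_ + _).
  by rewrite addr0 !addrA triple add0r triple.
by rewrite addbF add0r => /(canRL (addKr _)) ->; rewrite addNr.
Qed.

(* Six times a closed walk is a rearrangement of six-fold loops. *)
Lemma walk_closed b f s : all unitstep s -> \sum_(e <- s) e = 0 -> ~~ odd (size s) ->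
  walk b f s = 0.
Proof.
move=> us s0 /negbTE os.
have stay t : walk b f (s ++ t) = walk b f s + walk b f t.
  by rewrite walk_cat s0 os addr0 addbF.
pose t := flatten [seq nseq 6 e | e <- s].
have t0 : walk b f t = 0.
  rewrite /t; elim: s us b f {s0 os stay t} => [//|e s IH] /andP[ue us] b f.
  rewrite -[flatten _]/(nseq 6 e ++ flatten [seq nseq 6 e | e <- s]).
  by rewrite walk_cat walk_loop // add0r IH.
have pst : perm_eq (s ++ s ++ s ++ s ++ s ++ s) t.
  apply/permP=> a; rewrite /t !count_cat.
  by elim: s {us s0 os stay t t0} => //= e s IH; lia.
have ust : all unitstep (s ++ s ++ s ++ s ++ s ++ s) by rewrite !all_cat us.
have := walk_perm b f ust pst; rewrite t0 !stay => h; lia.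
Qed.

(** Both walks are closed by the same return [r], five more copies of [t]: six copies of [t] add up
    to 0 and have even length. *)
Lemma walk_endpoint b f s t : all unitstep s -> all unitstep t ->
  \sum_(e <- s) e = \sum_(e <- t) e -> odd (size s) = odd (size t) ->
  walk b f s = walk b f t.
Proof.
move=> us ut est ost; set r := t ++ t ++ t ++ t ++ t.
have t6 : \sum_(e <- t ++ r) e = 0.
  by rewrite /r !big_cat /= !addrA triple add0r triple.
have ht : walk b f (t ++ r) = 0.
  by apply: walk_closed; rewrite ?all_cat ?ut // !size_cat !oddD; case: odd.
have hs : walk b f (s ++ r) = 0.
  apply: walk_closed; first by rewrite !all_cat us ut.
    by rewrite big_cat /= est -big_cat t6.
  by rewrite !size_cat !oddD ost; case: odd.
by move: hs ht; rewrite !walk_cat est ost => <- /addIr.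
Qed.

(** The height of a vertex is the weight of a chosen walk to it from the zero function of copy
    [false]; [walk_endpoint] makes the choice immaterial. *)
Lemma longcode_height : exists h : bool -> {ffun D -> 'I_3} -> int,
  forall b f g, differ f g -> h (~~ b) g - h b f = colstep (F b f) (F (~~ b) g).
Proof.
have pathP x : exists s, [&& all unitstep s, \sum_(e <- s) e == x.2 & odd (size s) == x.1].
  have [s [us es os]] := reach false 0 x.1 x.2; exists s.
  by rewrite us es os subr0 !eqxx.
pose path x := xchoose (pathP x).
have pathE x : [/\ all unitstep (path x), \sum_(e <- path x) e = x.2 & odd (size (path x)) = x.1].
  by have /and3P[us /eqP es /eqP os] := xchooseP (pathP x).
exists (fun b f => walk false 0 (path (b, f))) => b f g dfg.
have [us es os] := pathE (b, f); have [ut et ot] := pathE (~~ b, g).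
have ue := differ_unitstep dfg.
rewrite (@walk_endpoint _ _ (path (~~ b, g)) (path (b, f) ++ [:: g - f])) //.
- by rewrite walk_cat es os /= add0r addr0 addrC addKr addrC subrK.
- by rewrite all_cat us /= ue.
- by rewrite et big_cat big_seq1 es /= addrC subrK.
- by rewrite size_cat ot addn1 /= os.
Qed.

End Unwound.

Section Wound.
(** This is what a hexagon with each [Base s p] coloured [p] imposes, since [Base s p] is adjacent
    to the functions of the other copy that avoid [p]. *)
Hypothesis F_range : forall b f p, (forall d, d \in U -> f d != p) -> F b f != p.

Definition two (S : {set D}) (p q : 'I_3) : {ffun D -> 'I_3} :=
  [ffun d => if d \in S then p else q].

Lemma two_range b S p q : F b (two S p q) = p \/ F b (two S p q) = q.
Proof.
have [->|np] := eqVneq (F b (two S p q)) p; first by left.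
have [->|nq] := eqVneq (F b (two S p q)) q; first by right.
suff: F b (two S p q) != F b (two S p q) by rewrite eqxx.
by apply: F_range => d _; rewrite ffunE eq_sym; case: ifP.
Qed.

Lemma two_turn b S p q r : p != q -> r != p ->
  F b (two S p q) = p -> F (~~ b) (two S r p) = r.
Proof.
move=> pq rp Fp; case: (two_range (~~ b) S r p) => // Fr.
suff: F b (two S p q) != F (~~ b) (two S r p) by rewrite Fp Fr eqxx.
by apply: F_proper => d _; rewrite !ffunE; case: ifP; rewrite // eq_sym.
Qed.

(** Turns link all ordered pairs of distinct colours in both copies, so whether [S] decides the
    colour depends on [S] alone. *)
Lemma two_all b S p q b' p' q' : p != q -> p' != q' ->
  F b (two S p q) = p -> F b' (two S p' q') = p'.
Proof.
have step1 b1 p1 q1 r : p1 != q1 -> r != p1 -> F b1 (two S p1 q1) = p1 ->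
  F (~~ b1) (two S r p1) = r by exact: two_turn.
have step2 b1 p1 q1 r r' : p1 != q1 -> r != p1 -> r' != r -> F b1 (two S p1 q1) = p1 ->
  F b1 (two S r' r) = r'.
  by move=> h1 h2 h3 /(step1 _ _ _ _ h1 h2) /(step1 _ _ _ _ h2 h3); rewrite negbK.
have other (x y : 'I_3) : exists z, (z != x) && (z != y).
  by move: x y; do 2 apply: ord3P; first [by exists 0 | by exists 1 | by exists 2].
move=> pq pq' Fp.
have all_b : forall r r', r' != r -> F b (two S r' r) = r'.
  move=> r r' rr'; have [z /andP[zp zr]] := other p r.
  have [z' /andP[z'z z'r]] := other z r.
  have Fz := step2 _ _ _ _ _ pq zp z'z Fp.
  by apply: (step2 b z' z r r' z'z) => //; rewrite eq_sym.
case: (altP (b' =P b)) => [->|]; first exact: all_b.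
move=> nb; have -> : b' = ~~ b by case: (b) (b') nb => [] [].
have [z /andP[zq _]] := other q' q'.
by apply: (step1 b q' z) => //; [rewrite eq_sym | apply: all_b; rewrite eq_sym].
Qed.

(* The large sets form an ultrafilter, principal because [D] is finite. *)
Definition large S := F false (two S 0 1) == 0.

Lemma largeE S b p q : p != q -> large S -> F b (two S p q) = p.
Proof. by move=> pq /eqP; apply: two_all. Qed.

Lemma large_split (S T : {set D}) : [disjoint S & T] -> large (S :|: T) -> large S \/ large T.
Proof.
move=> dST lST.
(* In copy [true], [g] cannot have colour 0 because of the largeness of the union. Colour 1 makes
   [S] large, colour 2 makes [T] large. *)
pose g : {ffun D -> 'I_3} := [ffun d => if d \in S then 1 else if d \in T then 2 else 0].
have Fg0 : F true g != 0.
  rewrite -(@largeE (S :|: T) false 0 1) // eq_sym; apply: F_proper => d _.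
  by rewrite !ffunE inE; case: (d \in S); case: (d \in T).
have TS d : d \in T -> d \notin S by move=> dT; rewrite (disjointFl dST dT).
have [Fg|Fg1] := eqVneq (F true g) 1.
  left; case: (two_range false S 0 1) => [/eqP //|F1].
  suff: F true g != F false (two S 0 1) by rewrite Fg F1 eqxx.
  by apply: F_proper => d _; rewrite !ffunE; case: ifP => // _; case: ifP.
have Fg : F true g = 2 by move: (F true g) Fg0 Fg1; apply: ord3P.
right; have F0 : F false (two T 0 2) = 0.
  case: (two_range false T 0 2) => // F2.
  suff: F true g != F false (two T 0 2) by rewrite Fg F2 eqxx.
  apply: F_proper => d _; rewrite !ffunE; case: ifP => [dS|_]; last by case: ifP.
  by rewrite (disjointFr dST dS).
by apply/eqP; apply: (@two_all false T 0 2 false 0 1).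
Qed.

Lemma dictator : exists2 d, d \in U &
  forall b p q, p != q -> F b (two [set d] p q) = p.
Proof.
have no_small (S : {set D}) : S \subset U -> large S -> exists2 d, d \in U & large [set d].
  elim: {S}_.+1 {-2}S (ltnSn #|S|) => // n IH S; rewrite ltnS => leSn SU lS.
  have [S0|[d dS]] := set_0Vmem S.
    suff: F false (two S 0 1) != 0 by rewrite (eqP lS).
    by apply: F_range => d _; rewrite ffunE S0 inE.
  have : large ([set d] :|: S :\ d) by rewrite setD1K.
  case/large_split; first by rewrite disjoints1 !inE eqxx.
    by move=> ld; exists d => //; apply: subsetP dS.
  move=> lS'; apply: (IH (S :\ d)) => //.
    by move: leSn; rewrite (cardsD1 d S) dS.
  exact: subset_trans (subsetDl _ _) SU.
have [|d dU ld] := no_small U (subxx _); last by exists d => // b p q pq; apply: largeE.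
apply/eqP; case: (two_range false U 0 1) => // F1.
suff: F false (two U 0 1) != 1 by rewrite F1.
by apply: F_range => d dU; rewrite ffunE dU.
Qed.

End Wound.
End LongCode.

(** * Recolouring along height functions *)

Section Recoloring.
Variables (k : nat) (G : graph).
Implicit Types c d : {ffun G -> 'I_k}.

Definition diff_set c d : {set G} := [set x | c x != d x].

(** Properness is part of the relation, so that paths run through plain functions instead of the
    dependent pairs of [coloring]. *)
Definition rstep : rel {ffun G -> 'I_k} :=
  fun c d => [&& proper c, proper d & #|diff_set c d| == 1].

Lemma rstep_sym : symmetric rstep.
Proof.
move=> c d; rewrite /rstep andbCA; do 2 congr (_ && _); congr (_ == _).
by apply: eq_card => x; rewrite !inE eq_sym.
Qed.

Lemma coloringP c : reflect (forall x y, adj x y -> c x != c y) (proper c).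
Proof.
apply: (iffP forallP) => [h x y xy|h x]; first by have /forallP/(_ y)/implyP/(_ xy) := h x.
by apply/forallP=> y; apply/implyP; apply: h.
Qed.

Lemma k_mixing_rstep :
  (forall c d, proper c -> proper d -> connect rstep c d) -> k_mixing k G.
Proof.
move=> conn [c pc] [d pd]; case/connectP: (conn c d pc pd) => s.
elim: s c pc => [|e s IH] c pc /=.
  by move=> _ dc; subst d; rewrite (bool_irrelevance pc pd) connect0.
case/andP=> /and3P[_ pe ce] es dl; apply: connect_trans (IH e pe es dl).
by apply: connect1.
Qed.

Lemma rstep_k_mixing c d : k_mixing k G -> proper c -> proper d -> connect rstep c d.
Proof.
move=> mix pc pd; pose col e (pe : proper e) : coloring k G := exist _ e pe.
have := mix (col c pc) (col d pd); case/connectP=> s.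
elim: s c pc => [|[e pe] s IH] c pc /=; first by move=> _ [->].
case/andP=> ce es el; apply: connect_trans (IH e pe es el).
by apply: connect1; rewrite /rstep pc pe.
Qed.

(** Only one vertex changes at a time, so when a core vertex is about to change, the rest of the
    core still has its colours from [c], and the hypothesis forbids the change. *)
Lemma frozen_core (core : pred G) c :
  (forall d v, proper d -> core v -> (forall y, y != v -> core y -> d y = c y) -> d v = c v) ->
  forall d, connect rstep c d -> forall x, core x -> d x = c x.
Proof.
move=> keep d /connectP[s]; elim/last_ind: s d => [|s d IH] e /=; first by move=> _ ->.
rewrite rcons_path last_rcons => /andP[ps /and3P[_ pd /cards1P[v dv]]] -> x xc.
have {}IH := IH _ ps erefl; set f := last _ _ in IH dv.
have deq y : y != v -> d y = f y.
  by move=> yv; apply/eqP; apply: contraNT yv => n; rewrite -in_set1 -dv inE eq_sym.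
have [xv|/deq ->] := eqVneq x v; last exact: IH.
subst x; apply: keep => // y yv yc; rewrite deq //; exact: IH.
Qed.

Lemma rstep_upd c d x : proper c -> proper d -> c x != d x ->
  (forall y, y != x -> c y = d y) -> rstep c d.
Proof.
move=> pc pd cdx cd; rewrite /rstep pc pd /= (_ : diff_set c d = [set x]) ?cards1 //.
apply/setP=> y; rewrite !inE; have [->|/cd ->] := eqVneq y x; first by rewrite cdx.
by rewrite eqxx.
Qed.

Section Classes.
Variables (T : finType) (cl : G -> T).
Hypothesis cl_adj : forall x y, adj x y -> cl x != cl y.

Definition class_coloring (l : T -> 'I_k) : {ffun G -> 'I_k} := [ffun x => l (cl x)].

Lemma class_move (l l' : {ffun T -> 'I_k}) t : injective l -> injective l' ->
  (forall u, u != t -> l u = l' u) ->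
  connect rstep (class_coloring l) (class_coloring l').
Proof.
move=> il il' ll'.
(* The vertices of class [t] are recoloured one at a time; those in [S] have already switched to
   [l']. *)
pose mix (S : {set G}) : {ffun G -> 'I_k} := [ffun x => if x \in S then l' (cl x) else l (cl x)].
have mix_proper S : proper (mix S).
  apply/coloringP=> x y /cl_adj nxy; rewrite !ffunE.
  have [ext|nxt] := eqVneq (cl x) t.
    have nyt : cl y != t by rewrite -ext eq_sym.
    by rewrite -(ll' _ nyt) if_same; case: ifP; rewrite ?(inj_eq il) // (ll' _ nyt) (inj_eq il').
  rewrite -(ll' _ nxt) if_same; case: ifP; rewrite ?(inj_eq il) //.
  by rewrite (ll' _ nxt) (inj_eq il').
have -> : class_coloring l = mix set0 by apply/ffunP=> x; rewrite !ffunE inE.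
have -> : class_coloring l' = mix setT by apply/ffunP=> x; rewrite !ffunE inE.
have conn S : connect rstep (mix set0) (mix S).
  elim: {S}_.+1 {-2}S (ltnSn #|S|) => // n IH S; rewrite ltnS => leSn.
  have [->|[x xS]] := set_0Vmem S; first exact: connect0.
  apply: connect_trans (IH (S :\ x) _) _; first by move: leSn; rewrite (cardsD1 x) xS.
  have [e|ne] := eqVneq (mix (S :\ x)) (mix S); first by rewrite e connect0.
  have eqy y : y != x -> mix (S :\ x) y = mix S y by move=> yx; rewrite !ffunE !inE yx.
  apply/connect1/(@rstep_upd _ _ x) => //.
  apply: contraNneq ne => e; apply/eqP/ffunP=> y.
  by have [->|/eqy] := eqVneq y x.
exact: conn.
Qed.

(** If the colour wanted by a wrongly coloured class [t] is free, [t] takes it. Otherwise the class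
    [u] that holds it, itself wrongly coloured, first retires to a spare colour [v]. *)
Lemma class_connected (l l' : {ffun T -> 'I_k}) : #|T| < k -> injective l -> injective l' ->
  connect rstep (class_coloring l) (class_coloring l').
Proof.
move=> ltTk + il'; elim: {l}_.+1 {-2}l (ltnSn #|[set t | l t != l' t]|) => // n IH l.
rewrite ltnS => led il.
have [/forallP ll'|] := boolP [forall t, l t == l' t].
  suff -> : l = l' by exact: connect0.
  by apply/ffunP=> t; apply/eqP.
rewrite negb_forall => /existsP[t nt].
pose upd (a : {ffun T -> 'I_k}) t0 v : {ffun T -> 'I_k} := [ffun u => if u == t0 then v else a u].
have upd_inj (a : {ffun T -> 'I_k}) t0 v : injective a -> (forall u, u != t0 -> a u != v) ->
    injective (upd a t0 v).
  move=> ia av u w; rewrite !ffunE; have [->|nu] := eqVneq u t0; have [->|nw] := eqVneq w t0 => //.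
  - by move=> e; have := av _ nw; rewrite e eqxx.
  - by move=> e; have := av _ nu; rewrite e eqxx.
  - by move/ia.
have upd_conn (a : {ffun T -> 'I_k}) t0 v : injective a -> injective (upd a t0 v) ->
    connect rstep (class_coloring a) (class_coloring (upd a t0 v)).
  by move=> ia iu; apply: (@class_move _ _ t0) => // u nu; rewrite ffunE (negbTE nu).
have fix_t (a : {ffun T -> 'I_k}) : injective a -> (forall u, a u != l' t) -> a t != l' t ->
    #|[set u | a u != l' u]| <= n -> connect rstep (class_coloring a) (class_coloring l').
  move=> ia av nat le.
  have iu : injective (upd a t (l' t)) by apply: upd_inj.
  apply: connect_trans (upd_conn _ _ _ ia iu) (IH _ _ iu).
  apply: leq_trans le; rewrite [X in _ < X](cardsD1 t) inE nat add1n ltnS.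
  apply/subset_leq_card/subsetP=> u; rewrite !inE ffunE.
  by have [->|_] := eqVneq u t; rewrite ?eqxx.
have [/forallP av|] := boolP [forall u, l u != l' t]; first exact: (fix_t l il).
rewrite negb_forall => /existsP[u]; rewrite negbK => /eqP lu.
have [v nv] : exists v, v \notin codom l.
  apply/existsP; rewrite -negb_forall; apply/negP=> /forallP allc.
  have := card_codom il; rewrite (eq_card (B := 'I_k)) ?card_ord => [e|w]; last by rewrite allc.
  by rewrite e ltnn in ltTk.
have nvl w : l w != v by apply: contraNneq nv => <-; exact: codom_f.
have iu : injective (upd l u v) by apply: upd_inj.
have nut : u != t by apply: contraNneq nt => ut; rewrite -lu ut.
apply: connect_trans (upd_conn _ _ _ il iu) (fix_t _ iu _ _ _).
- move=> w; rewrite ffunE; have [_|nw] := eqVneq w u; first by rewrite -lu eq_sym.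
  by rewrite -lu (inj_eq il).
- by rewrite ffunE (eq_sym t) (negbTE nut).
- apply: leq_trans led; apply/subset_leq_card/subsetP=> w; rewrite !inE ffunE.
  have [->|//] := eqVneq w u => _; rewrite lu (inj_eq il').
  by rewrite eq_sym.
Qed.

End Classes.
End Recoloring.

(* The vertices in the domain of [zed] dominate the graph; the others carry a bipartition
   [side] and, in any colouring, use three colours only. *)
Section Palette.
Local Open Scope ring_scope.
Variables (m : nat) (G : graph) (zed : G -> option 'I_m) (side : G -> bool).
Hypothesis zed_inj : forall x y l, zed x = Some l -> zed y = Some l -> x = y.
Hypothesis zed_surj : forall l, exists x, zed x = Some l.
Hypothesis zed_adj : forall x y, zed x -> y != x -> adj x y.
Hypothesis side_adj : forall x y, adj x y -> ~~ zed x -> ~~ zed y -> side x != side y.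

Let k := m.+3.

(** The dominating vertices are pairwise adjacent and adjacent to all others: they use up [m]
    colours, and [tau] enumerates the three left over. *)
Lemma palette (c : {ffun G -> 'I_k}) : proper c ->
  exists (tau : 'I_3 -> 'I_k) (F : G -> 'I_3), [/\ injective tau,
    forall x, ~~ zed x -> c x = tau (F x) & forall x i, zed x -> c x != tau i].
Proof.
move=> /coloringP pc.
have zvP l : exists x, zed x == Some l by have [x xl] := zed_surj l; exists x; apply/eqP.
pose zv l := xchoose (zvP l).
have zvE l : zed (zv l) = Some l by apply/eqP/(xchooseP (zvP l)).
have zv_c x : zed x -> exists l, x = zv l.
  by case E: (zed x) => [l|//] _; exists l; apply: zed_inj E (zvE l).
pose A := [set c (zv l) | l : 'I_m].
have cA : #|~: A| = 3.
  have : #|A| = m.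
    rewrite card_imset ?card_ord // => l l' e; apply/eqP; apply: contraTT isT => nl.
    have : adj (zv l) (zv l').
      apply: zed_adj; first by rewrite zvE.
      by apply: contraNneq nl => e'; have := zvE l; rewrite -e' zvE => -[->].
    by move/pc; rewrite e eqxx.
  by have := cardsC A; rewrite card_ord /k; lia.
pose tau (i : 'I_3) := enum_val (cast_ord (esym cA) i).
have tau_inj : injective tau by move=> i j /enum_val_inj/cast_ord_inj.
(* The default 0 is reached at dominating vertices only. *)
pose F x := odflt 0 [pick i | tau i == c x].
exists tau, F; split=> // [x nx|x i zx].
  rewrite /F; case: pickP => [i /eqP //|] np.
  have cx : c x \in ~: A.
    rewrite inE; apply/negP=> /imsetP[l _ e].
    have /pc : adj (zv l) x.
      by apply: zed_adj; rewrite ?zvE //; apply: contraNneq nx => ->; rewrite zvE.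
    by rewrite e eqxx.
  have := np (cast_ord cA (enum_rank_in cx (c x))).
  by rewrite /tau cast_ordK enum_rankK_in ?eqxx.
have [l ->] := zv_c x zx; apply/eqP=> e.
have := enum_valP (cast_ord (esym cA) i); rewrite inE -/(tau i) -e => /imsetP[].
by exists l.
Qed.

Definition is_height (F : G -> 'I_3) (h : G -> int) :=
  forall x, ~~ zed x ->
    [/\ (h x)%:~R = F x :> 'Z_3, (h x %% 2)%Z = side x
      & forall y, ~~ zed y -> adj x y -> h y - h x = 1 \/ h y - h x = -1].

Definition tint (tau : 'I_3 -> 'I_k) (c : {ffun G -> 'I_k}) (h : G -> int) : {ffun G -> 'I_k} :=
  [ffun x => if zed x then c x else tau ((h x)%:~R : 'Z_3)].

Section Flatten.
Variables (tau : 'I_3 -> 'I_k) (c : {ffun G -> 'I_k}).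
Hypotheses (pc : proper c) (tau_inj : injective tau).
Hypothesis tau_zed : forall x i, zed x -> c x != tau i.

Definition valid_height (h : G -> int) :=
  forall x, ~~ zed x -> (h x %% 2)%Z = side x /\
    forall y, ~~ zed y -> adj x y -> h y - h x = 1 \/ h y - h x = -1.

Lemma tint_proper h : valid_height h -> proper (tint tau c h).
Proof.
move=> vh; apply/coloringP=> x y xy; rewrite !ffunE.
have [zx|nzx] := boolP (zed x); have [zy|nzy] := boolP (zed y).
- by move/coloringP: pc; apply.
- exact: tau_zed.
- by rewrite eq_sym; apply: tau_zed.
rewrite (inj_eq tau_inj); have [_ /(_ y nzy xy) hh] := vh x nzx.
rewrite -(subr_eq0 ((h x)%:~R : 'Z_3)) -rmorphB /=.
by case: hh => e; [rewrite (_ : _ - _ = -1) | rewrite (_ : _ - _ = 1)] => //; lia.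
Qed.

(** A local extremum is reflected in the common height of its neighbours. Moving by two keeps the
    parity, and the edges at the vertex keep steps of one. *)
Lemma height_move h x (e : int) : e = 1 \/ e = -1 -> valid_height h -> ~~ zed x ->
  (forall y, ~~ zed y -> adj x y -> h y - h x = e) ->
  exists h', [/\ valid_height h', h' x = h x + e + e, forall y, y != x -> h' y = h y
    & connect (@rstep k G) (tint tau c h) (tint tau c h')].
Proof.
move=> e1 vh nzx hx; pose h' y := if y == x then h x + e + e else h y.
have h'x : h' x = h x + e + e by rewrite /h' eqxx.
have h'y y : y != x -> h' y = h y by rewrite /h' => /negbTE ->.
have vh' : valid_height h'.
  move=> y nzy; have [vy adjy] := vh y nzy; have [eyx|nyx] := eqVneq y x.
    subst y; rewrite h'x; split; first by move: vy e1; lia.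
    move=> z nzz xz; rewrite h'y; last by apply: contraTneq xz => ->; rewrite adj_irr.
    by have := hx z nzz xz; lia.
  rewrite h'y //; split=> // z nzz yz.
  have [ezx|nzx'] := eqVneq z x; last by rewrite h'y //; apply: adjy.
  subst z; rewrite h'x; have := hx y nzy; rewrite adj_sym yz => /(_ isT); lia.
exists h'; split=> //; apply/connect1/(@rstep_upd _ _ _ _ x).
- exact: tint_proper.
- exact: tint_proper.
- rewrite !ffunE (negbTE nzx) h'x (inj_eq tau_inj) eq_sym.
  rewrite -(subr_eq0 _ ((h x)%:~R : 'Z_3)) -rmorphB /=.
  by case: e1 => ->; [rewrite (_ : _ - _ = 2) | rewrite (_ : _ - _ = -2)] => //; lia.
- by move=> y nyx; rewrite !ffunE h'y.
Qed.

(** A maximum above 1 can be lowered and a minimum below 0 raised, and either decreases the total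
    distance [mu] to the target. Once all heights are 0 or 1, parity identifies them with the
    side. *)
Lemma flatten_height h : valid_height h ->
  connect (@rstep k G) (tint tau c h) (tint tau c (fun x => side x)).
Proof.
pose mu h := (\sum_(x | ~~ zed x) `|h x - side x|)%N.
elim: {h}_.+1 {-2}h (ltnSn (mu h)) => // n IH h; rewrite ltnS => le vh.
have mu_lt h' x : ~~ zed x -> (forall y, y != x -> h' y = h y) ->
    (`|h' x - side x| < `|h x - side x|)%N -> (mu h' < n)%N.
  move=> nzx hh lt; apply: leq_trans le.
  rewrite /mu (bigD1 x) //= [X in (_ < X)%N](bigD1 x) //= -addSn leq_add //.
  by apply: leq_sum => y /andP[_ yx]; rewrite hh.
have [/existsP[x /andP[nzx hx]]|no_big] := boolP [exists x, ~~ zed x && (1 < h x)].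
  have [y nzy ymax] := @Order.TotalTheory.arg_maxP _ _ _ x (fun x => ~~ zed x) h nzx.
  have hy := Order.POrderTheory.lt_le_trans hx (ymax x nzx).
  have [vy adjy] := vh y nzy.
  have [||h' [vh' h'y hh cc]] := @height_move h y (-1) _ vh nzy; first by right.
    by move=> z nzz yz; have := adjy z nzz yz; have := ymax z nzz; lia.
  apply: connect_trans cc (IH h' _ vh'); apply: (mu_lt h' y nzy hh).
  by rewrite h'y; move: vy; case: (side y); lia.
have [/existsP[x /andP[nzx hx]]|no_small] := boolP [exists x, ~~ zed x && (h x < 0)].
  have [y nzy ymin] := @Order.TotalTheory.arg_minP _ _ _ x (fun x => ~~ zed x) h nzx.
  have hy := Order.POrderTheory.le_lt_trans (ymin x nzx) hx.
  have [vy adjy] := vh y nzy.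
  have [||h' [vh' h'y hh cc]] := @height_move h y 1 _ vh nzy; first by left.
    by move=> z nzz yz; have := adjy z nzz yz; have := ymin z nzz; lia.
  apply: connect_trans cc (IH h' _ vh'); apply: (mu_lt h' y nzy hh).
  by rewrite h'y; move: vy; case: (side y); lia.
suff -> : tint tau c h = tint tau c (fun x => side x) by exact: connect0.
apply/ffunP=> x; rewrite !ffunE; case: ifP => // /negbT nzx; congr tau.
have [] := vh x nzx; move: no_big no_small; rewrite !negb_exists.
move=> /forallP/(_ x) + /forallP/(_ x); rewrite nzx /= => b s v _.
by congr (_%:~R); move: b s v; case: (side x); lia.
Qed.

End Flatten.

Definition vclass x : 'I_m + bool := if zed x is Some l then inl l else inr (side x).

Lemma vclass_adj x y : adj x y -> vclass x != vclass y.
Proof.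
move=> xy; rewrite /vclass; have := side_adj xy.
case ex: (zed x) => [l|]; case ey: (zed y) => [l'|] //= h; last exact: h.
apply/eqP=> -[e]; subst l'; have exy := zed_inj ex ey; subst y.
by move: xy; rewrite adj_irr.
Qed.

(** Flattening its height turns any colouring into one that is constant on the two sides. With the
    dominating vertices this makes [m + 2] classes for [m + 3] colours, so [class_connected] joins
    all of these. *)
Theorem height_mixing :
  (forall (tau : 'I_3 -> 'I_k) (c : {ffun G -> 'I_k}) (F : G -> 'I_3),
     proper c -> injective tau -> (forall x, ~~ zed x -> c x = tau (F x)) ->
     exists h, is_height F h) ->
  k_mixing k G.
Proof.
move=> hyp; apply: k_mixing_rstep.
have to_class c : proper c -> exists2 l : {ffun 'I_m + bool -> 'I_k}, injective l &
    connect (@rstep k G) c (class_coloring vclass l).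
  move=> pc; have [tau [F [ti cF zt]]] := palette pc.
  have [h hh] := hyp tau c F pc ti cF.
  have vh : valid_height h by move=> x nzx; have [_ ? ?] := hh x nzx.
  have ec : c = tint tau c h.
    apply/ffunP=> x; rewrite ffunE; case: ifP => // /negbT nzx.
    by have [-> _ _] := hh x nzx; exact: cF.
  have zvP i : exists x, zed x == Some i by have [x xl] := zed_surj i; exists x; apply/eqP.
  have zvE i := eqP (xchooseP (zvP i)).
  exists [ffun t : 'I_m + bool =>
    match t with inl i => c (xchoose (zvP i)) | inr b => tau (b : nat)%:R end].
    have /coloringP pcP := pc.
    have ne i t : c (xchoose (zvP i)) != tau t by apply: zt; rewrite zvE.
    move=> [i|b] [j|b']; rewrite !ffunE => e.
    - congr inl; apply/eqP; apply: contraTT isT => nij.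
      have /pcP : adj (xchoose (zvP i)) (xchoose (zvP j)).
        apply: zed_adj; first by rewrite zvE.
        by apply: contraNneq nij => e'; have := zvE i; rewrite -e' zvE => -[->].
      by rewrite e eqxx.
    - by have := ne i (b' : nat)%:R; rewrite e eqxx.
    - by have := ne j (b : nat)%:R; rewrite -e eqxx.
    - by move/ti: e; case: b; case: b'.
  rewrite {1}ec (_ : class_coloring _ _ = tint tau c (fun x => side x)).
    exact: flatten_height.
  apply/ffunP=> x; rewrite !ffunE /vclass; case ex: (zed x) => [l|] /=; last by case: (side x).
  by congr (c _); apply: zed_inj ex; apply: zvE.
move=> c d pc pd; have [l il cl] := to_class c pc; have [l' il' dl'] := to_class d pd.
apply: connect_trans cl _; rewrite (sym_connect_sym (@rstep_sym k G)).
apply: connect_trans dl' _; apply: class_connected => //; first exact: vclass_adj.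
by rewrite card_sum card_ord card_bool /k; lia.
Qed.

End Palette.

(** * The gadget *)

Definition kind (D Gam : finType) (m : nat) : finType :=
  (((bool * {ffun D -> 'I_3}) + Gam) + (bool * 'I_3) + 'I_m)%type.

Notation Win s f := (inl (inl (inl (s, f)))).
Notation Link g := (inl (inl (inr g))).
Notation Base s p := (inl (inr (s, p))).
Notation Zed l := (inr l).

(* [Win s f] is the function [f] in the copy [s] of a long code, [Base s p]
   behaves as the constant function [p] in every long code, [Zed l] dominates everything,
   and [Link g] acts, in the long codes it is joined to by a projection [r], as the function
   that is 0 where [r] takes the value [g] and 2 elsewhere. [Base] and [Zed] are only active
   at the origin of the index set, which [o] and [o'] test for; the inactive copies are
   adjacent to dominating vertices only. *)
Section HalfAdjacency.
Local Open Scope ring_scope.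
Variables (D Gam : finType) (m : nat).

Definition half_adj (o o' same : bool) (U U' : {set D}) (pi : option (D -> Gam))
    (x y : kind D Gam m) : bool :=
  match x, y with
  | Base s p, Base s' q => [&& o, o', s != s' & p != q]
  | Base s p, Win s' f => [&& o, s != s' & [forall d in U', f d != p]]
  | Win s f, Win s' f' => [&& same, s != s' & [forall d in U, f d != f' d]]
  | Link g, Base s p => [&& o', ~~ s & p == 1]
  | Link g, Win s f => ~~ s &&
      (if pi is Some r then [forall d in U', f d != (if r d == g then 0 else 2)] else false)
  | Zed l, Zed l' => o && (if o' then l != l' else true)
  | Zed _, _ => o
  | _, _ => false
  end.

End HalfAdjacency.

Section Gadget.
Local Open Scope ring_scope.
Variables (I D Gam : finType) (m : nat) (o : I).
Variables (U : I -> {set D}) (pr : I -> I -> option (D -> Gam)).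

Let vtx : finType := (I * kind D Gam m)%type.
Implicit Types x y : vtx.

(** [half_adj] expects a link before a window, so the projection goes from the index of [y] to that
    of [x]. *)
Definition gtri x y :=
  half_adj (x.1 == o) (y.1 == o) (x.1 == y.1) (U x.1) (U y.1) (pr y.1 x.1) x.2 y.2.
Definition gadj x y := gtri x y || gtri y x.

Lemma gadj_sym : symmetric gadj.
Proof. by move=> x y; rewrite /gadj orbC. Qed.

Lemma gadj_irr : irreflexive gadj.
Proof.
move=> [i [[[[s f]|g]|[s p]]|l]]; rewrite /gadj orbb /gtri /= ?eqxx ?andbF //.
by case: (i == o).
Qed.

Definition gadget : graph := Graph gadj_sym gadj_irr.

Definition gzed x : option 'I_m :=
  if x.2 is Zed l then (if x.1 == o then Some l else None) else None.

Definition gside x : bool :=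
  match x.2 with Win s _ => s | Link _ => true | Base s _ => s | Zed _ => false end.

Lemma gzed_inj x y l : gzed x = Some l -> gzed y = Some l -> x = y.
Proof.
move: x y => [i [//|l1]] [j [//|l2]]; rewrite /gzed /=.
by case: eqP => // -> [->]; case: eqP => // -> [->].
Qed.

Lemma gzed_surj l : exists x, gzed x = Some l.
Proof. by exists (o, Zed l); rewrite /gzed /= eqxx. Qed.

Lemma gzed_adj x y : gzed x -> y != x -> gadj x y.
Proof.
case: x => [i [//|l]]; rewrite /gzed /=; case: eqP => // -> _.
case: y => [j [[[[s f]|g]|[s p]]|l']] nxy; rewrite /gadj /gtri /= eqxx //=.
case: ifP => // /eqP ej; apply/orP; left; apply: contraNneq nxy => <-.
by rewrite ej.
Qed.

Lemma gside_adj x y : gadj x y -> ~~ gzed x -> ~~ gzed y -> gside x != gside y.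
Proof.
have half x' y' : gtri x' y' -> ~~ gzed x' -> ~~ gzed y' -> gside x' != gside y'.
  move: x' y' => [i [[[[s f]|g]|[s p]]|l]] [j [[[[s' f']|g']|[s' p']]|l']];
  rewrite /gtri /gzed /gside /=; try by case: (i == o).
  - by case/and3P.
  - by case: s'.
  - by case/and3P=> _ + _; case: s'.
  - by case/and3P.
  - by case/and4P.
case/orP=> [/half //|/half h] nx ny; rewrite eq_sym; exact: h.
Qed.

(** This is the label cover problem that the gadget encodes. *)
Definition sat := exists a : I -> D, (forall i, a i \in U i) /\
  forall i i' j r r', pr i j = Some r -> pr i' j = Some r' -> r (a i) = r' (a i').

Section Coloring.
Variable F : vtx -> 'I_3.
Hypothesis F_adj : forall x y, gadj x y -> ~~ gzed x -> ~~ gzed y -> F x != F y.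

Let FW i (s : bool) (f : {ffun D -> 'I_3}) : 'I_3 := F (i, Win s f).
Let FB (s : bool) (p : 'I_3) : 'I_3 := F (o, Base s p).

Lemma FW_proper i b f g : differ (U i) f g -> FW i b f != FW i (~~ b) g.
Proof.
move=> dfg; apply: F_adj => //; rewrite /gadj /gtri /= eqxx /=.
apply/orP; left; apply/andP; split; first by case: b.
by apply/forallP=> d; apply/implyP; apply: dfg.
Qed.

Lemma FB_FW i b p (f : {ffun D -> 'I_3}) :
  (forall d, d \in U i -> f d != p) -> FB b p != FW i (~~ b) f.
Proof.
move=> dfp; apply: F_adj => //; rewrite /gadj /gtri /= eqxx /=.
apply/orP; left; apply/andP; split; first by case: b.
by apply/forallP=> d; apply/implyP; apply: dfp.
Qed.

Lemma FB_FB b p q : p != q -> FB b p != FB (~~ b) q.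
Proof.
by move=> pq; apply: F_adj => //; rewrite /gadj /gtri /= !eqxx /= pq; case: b.
Qed.

Lemma FL_FW j g i (f : {ffun D -> 'I_3}) r : pr i j = Some r ->
  (forall d, d \in U i -> f d != (if r d == g then 0 else 2)) ->
  F (j, Link g) != FW i false f.
Proof.
move=> rij h; apply: F_adj => //; rewrite /gadj /gtri /= rij.
by apply/orP; left; apply/forallP=> d; apply/implyP; apply: h.
Qed.

Lemma FL_FB j g : F (j, Link g) != FB false 1.
Proof. by apply: F_adj => //; rewrite /gadj /gtri /= !eqxx. Qed.

(** Every long code has a dictator. If two of them project differently to [j], the link vertex of
    the first projection sees colour 1 on the hexagon, 2 in the first long code and 0 in the
    second. *)
Lemma rainbow_sat : (forall b p, FB b p = p) -> sat.
Proof.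
move=> FBp; have rng i b (f : {ffun D -> 'I_3}) p :
    (forall d, d \in U i -> f d != p) -> FW i b f != p.
  by move=> h; have := @FB_FW i (~~ b) p f h; rewrite negbK FBp eq_sym.
have dic i : exists d, (d \in U i) &&
    [forall b, [forall p, [forall q, (p != q) ==> (FW i b (two [set d] p q) == p)]]].
  have [d dU h] := @dictator D (U i) (FW i) (@FW_proper i) (@rng i).
  exists d; rewrite dU /=; apply/forallP=> b; apply/forallP=> p; apply/forallP=> q.
  by apply/implyP=> pq; rewrite h.
exists (fun i => xchoose (dic i)).
have dicE i : xchoose (dic i) \in U i /\
    forall b p q, p != q -> FW i b (two [set xchoose (dic i)] p q) = p.
  have /andP[dU h] := xchooseP (dic i); split=> // b p q pq; apply/eqP.
  by move: h => /forallP/(_ b)/forallP/(_ p)/forallP/(_ q)/implyP; apply.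
split=> [i|i i' j r r' rij rij']; first by have [] := dicE i.
move: (xchoose (dic i)) (xchoose (dic i')) (dicE i) (dicE i') => d d' [dU Fd] [dU' Fd'].
apply/eqP; apply: contraT => nr.
have F1 : F (j, Link (r d)) != 1 by rewrite -(FBp false 1); apply: FL_FB.
have F2 : F (j, Link (r d)) != 2.
  rewrite -(Fd false 2 1) //; apply: (FL_FW rij) => e _; rewrite ffunE inE.
  by have [->|_] := eqVneq e d; rewrite ?eqxx //; case: ifP.
have F0 : F (j, Link (r d)) != 0.
  rewrite -(Fd' false 0 1) //; apply: (FL_FW rij') => e _; rewrite ffunE inE.
  have [->|_] := eqVneq e d'; last by case: ifP.
  by rewrite eq_sym in nr; rewrite (negbTE nr).
by move: (F _) F0 F1 F2; apply: ord3P.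
Qed.

(** Heights that fit the colours on three edges of a 4-cycle fit on the fourth, which is how
    separately built height functions are glued. *)
Lemma sum_fit (h1 h2 h3 h4 : int) (c1 c2 c3 c4 : 'I_3) :
  c1 != c2 -> c2 != c3 -> c3 != c4 -> c1 != c4 ->
  h2 - h1 = colstep c1 c2 -> h3 - h2 = colstep c2 c3 -> h4 - h3 = colstep c3 c4 ->
  h4 - h1 = colstep c1 c4.
Proof. by move=> n1 n2 n3 n4 e1 e2 e3; rewrite -(colstep3 n1 n2 n3 n4) -e1 -e2 -e3; ring. Qed.

Lemma fitC (h1 h2 : int) (c1 c2 : 'I_3) : c1 != c2 ->
  h2 - h1 = colstep c1 c2 -> h1 - h2 = colstep c2 c1.
Proof. by move=> n e; rewrite colstepC // -e; ring. Qed.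

Section Unwound.
Variable p0 : 'I_3.
Hypothesis unwound : FB false p0 != FB true p0.

Lemma base_height : exists hB : bool -> 'I_3 -> int,
  (forall b p q, p != q -> hB (~~ b) q - hB b p = colstep (FB b p) (FB (~~ b) q)) /\
  hB false 0 = 4 * (FB false 0 : nat)%:Z.
Proof.
(* The hexagon is the long code of a one-point set. *)
pose Fu b (f : {ffun unit -> 'I_3}) := FB b (f tt).
have Fu_proper b f g : differ setT f g -> Fu b f != Fu (~~ b) g.
  by move=> /(_ tt (in_setT _)); apply: FB_FB.
have [|h hh] := @longcode_height _ setT Fu Fu_proper false [ffun=> p0].
  by rewrite /Fu ffunE.
(* Four times a colour is even, as the side [false] requires, and congruent to the colour modulo
   3. *)
pose hB b p := h b [ffun=> p] - h false [ffun=> 0] + 4 * (FB false 0 : nat)%:Z.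
exists hB; split=> [b p q pq|]; last by rewrite /hB subrr add0r.
have := hh b [ffun=> p] [ffun=> q]; rewrite /Fu !ffunE => <-; first by rewrite /hB; ring.
by move=> d _; rewrite !ffunE.
Qed.

Lemma window_height (hB : bool -> 'I_3 -> int) i :
  (forall b p q, p != q -> hB (~~ b) q - hB b p = colstep (FB b p) (FB (~~ b) q)) ->
  exists hW : bool -> {ffun D -> 'I_3} -> int,
    (forall b f g, differ (U i) f g -> hW (~~ b) g - hW b f = colstep (FW i b f) (FW i (~~ b) g)) /\
    (forall b p (f : {ffun D -> 'I_3}), (forall d, d \in U i -> f d != p) ->
      hW (~~ b) f - hB b p = colstep (FB b p) (FW i (~~ b) f)).
Proof.
move=> hBE; pose cst p : {ffun D -> 'I_3} := [ffun=> p].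
have cst_ne p q : p != q -> forall d, d \in U i -> cst p d != q by move=> pq d _; rewrite ffunE.
(* If the two copies of every constant agreed here, the three constants would have distinct colours
   and force the same colours on the hexagon, against [unwound]. *)
have nwin : exists p, FW i false (cst p) != FW i true (cst p).
  apply/existsP; apply: contraT; rewrite negb_exists => /forallP eqc.
  have FBe b p : FB b p = FW i false (cst p).
    have two_c q : q != p -> FB b p != FW i false (cst q).
      move=> qp; have e := eqP (negbNE (eqc q)).
      have := @FB_FW i b p (cst q) (cst_ne _ _ qp); case: b => //=; by rewrite e.
    have ww q : q != p -> FW i false (cst p) != FW i false (cst q).
      move=> qp; rewrite [X in _ != X](eqP (negbNE (eqc q))).
      by apply: FW_proper => d _; rewrite !ffunE eq_sym.
    have w12 q q' : q != q' -> FW i false (cst q) != FW i false (cst q').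
      move=> qq; rewrite [X in _ != X](eqP (negbNE (eqc q'))).
      by apply: FW_proper => d _; rewrite !ffunE.
    have [q [q' [qp q'p qq']]] : exists q q' : 'I_3, [/\ q != p, q' != p & q != q'].
      by move: (p); apply: ord3P; [exists 1, 2|exists 0, 2|exists 0, 1].
    move: (two_c q qp) (two_c q' q'p) (ww q qp) (ww q' q'p) (w12 q q' qq').
    move: (FB b p) (FW i false (cst p)) (FW i false (cst q)) (FW i false (cst q')).
    by do 4 (apply: ord3P).
  by move: unwound; rewrite !FBe eqxx.
have [p1 np1] := nwin.
have [h hh] := @longcode_height _ (U i) (FW i) (@FW_proper i) false (cst p1) np1.
(* The shift makes [hW] fit [hB] on the edge from [Base true 1] to the constant 0; [sum_fit] carries
   this to the other edges. *)
pose hW b f := h b f - h false (cst 0) + hB true 1 + colstep (FB true 1) (FW i false (cst 0)).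
have hWE b f g : differ (U i) f g -> hW (~~ b) g - hW b f = colstep (FW i b f) (FW i (~~ b) g).
  by move=> /hh <-; rewrite /hW; ring.
exists hW; split=> //.
pose fit b p := exists2 q, q != p &
    hW b (cst p) - hB (~~ b) q = colstep (FB (~~ b) q) (FW i b (cst p)).
have fit_turn b p p' : p' != p -> fit b p ->
    hW (~~ b) (cst p') - hB b p = colstep (FB b p) (FW i (~~ b) (cst p')).
  move=> pp' [q qp hq].
  apply: (@sum_fit _ (hB (~~ b) q) (hW b (cst p)) _ _ (FB (~~ b) q) (FW i b (cst p))).
  - by apply: FB_FB; rewrite eq_sym.
  - rewrite -{2}(negbK b); apply: FB_FW; apply: cst_ne; by rewrite eq_sym.
  - by apply: FW_proper => d _; rewrite !ffunE eq_sym.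
  - by apply: FB_FW; apply: cst_ne.
  - by apply: hBE; rewrite eq_sym.
  - exact: hq.
  - by apply: hWE => d _; rewrite !ffunE eq_sym.
have fit_step b p p' : p' != p -> fit b p -> fit (~~ b) p'.
  by move=> pp' fp; exists p; rewrite 1?eq_sym // negbK; apply: fit_turn.
have fit00 : fit false 0 by exists 1; rewrite // /hW /=; ring.
have fit_all b p : fit b p.
  have f1 p' : p' != 0 -> fit true p' by move=> np; apply: (fit_step false 0).
  have f2 p' : fit false p'.
    have [->|np] := eqVneq p' 1; first by apply: (fit_step true 2) => //; apply: f1.
    by apply: (fit_step true 1) => //; apply: f1.
  case: b => //; have [->|np] := eqVneq p 1; first by apply: (fit_step false 2).
  exact: (fit_step false 1).
move=> b p f pf; have [q qp hq] := fit_all b p.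
apply: (@sum_fit _ (hB (~~ b) q) (hW b (cst p)) _ _ (FB (~~ b) q) (FW i b (cst p))).
- by apply: FB_FB; rewrite eq_sym.
- rewrite -{2}(negbK b); apply: FB_FW; apply: cst_ne; by rewrite eq_sym.
- by apply: FW_proper => d dU; rewrite !ffunE eq_sym pf.
- exact: FB_FW.
- by apply: hBE; rewrite eq_sym.
- exact: hq.
- by apply: hWE => d dU; rewrite !ffunE eq_sym pf.
Qed.

Lemma step_color_parity (h h' : int) (c c' : 'I_3) (b : bool) : c != c' ->
  h' - h = colstep c c' -> h%:~R = c :> 'Z_3 -> (h %% 2)%Z = b ->
  h'%:~R = c' :> 'Z_3 /\ (h' %% 2)%Z = ~~ b.
Proof.
move=> cc' e hc hb; split; last first.
  by have := colstep_pm c c'; rewrite -e; move: hb; case: b => /=; lia.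
have -> : h' = h + colstep c c' by rewrite -e; ring.
by rewrite rmorphD /= hc colstep_mod3 // addrC subrK.
Qed.

Lemma gadget_height : exists h : vtx -> int,
  forall x, ~~ gzed x ->
    [/\ (h x)%:~R = F x :> 'Z_3, (h x %% 2)%Z = gside x
      & forall y, ~~ gzed y -> gadj x y -> h y - h x = 1 \/ h y - h x = -1].
Proof.
have [hB [hBE hB0]] := base_height.
have [hW hWE] : exists hW : I -> bool -> {ffun D -> 'I_3} -> int, forall i,
    (forall b f g, differ (U i) f g ->
      hW i (~~ b) g - hW i b f = colstep (FW i b f) (FW i (~~ b) g)) /\
    (forall b p (f : {ffun D -> 'I_3}), (forall d, d \in U i -> f d != p) ->
      hW i (~~ b) f - hB b p = colstep (FB b p) (FW i (~~ b) f)).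
  exact: (fin_all_exists (fun i => @window_height hB i hBE)).
pose hL j g := hB false 1 + colstep (FB false 1) (F (j, Link g)).
(* Inactive vertices have only dominating neighbours, so any height with the right residues will do:
   [4c + 3b] is [c] modulo 3 and [b] modulo 2. *)
pose dummy (b : bool) (c : 'I_3) : int := 4 * (c : nat)%:Z + 3 * (b : nat)%:Z.
pose h (x : vtx) : int := match x.2 with
  | Win s f => hW x.1 s f
  | Link g => hL x.1 g
  | Base s p => if x.1 == o then hB s p else dummy s (F x)
  | Zed _ => dummy false (F x)
  end.
have dummyE b c : (dummy b c)%:~R = c :> 'Z_3 /\ (dummy b c %% 2)%Z = b.
  split; last by rewrite /dummy; move: (nat_of_ord c) => n; case: b => /=; lia.
  by case: b; move: c; apply: ord3P; apply/eqP.
have hB_ok b p : (hB b p)%:~R = FB b p :> 'Z_3 /\ (hB b p %% 2)%Z = b.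
  have sp b1 p1 q1 : p1 != q1 -> (hB b1 p1)%:~R = FB b1 p1 :> 'Z_3 /\ (hB b1 p1 %% 2)%Z = b1 ->
      (hB (~~ b1) q1)%:~R = FB (~~ b1) q1 :> 'Z_3 /\ (hB (~~ b1) q1 %% 2)%Z = ~~ b1.
    move=> pq [e1 e2]; apply: step_color_parity e1 e2; first exact: FB_FB.
    exact: hBE.
  have h00 : (hB false 0)%:~R = FB false 0 :> 'Z_3 /\ (hB false 0%R %% 2)%Z = false.
    by rewrite hB0; have := dummyE false (FB false 0); rewrite /dummy mulr0 addr0.
  have f1 p' : p' != 0 -> (hB true p')%:~R = FB true p' :> 'Z_3 /\ (hB true p' %% 2)%Z = true.
    by move=> np; apply: (sp false 0) h00; rewrite eq_sym.
  have f2 p' : (hB false p')%:~R = FB false p' :> 'Z_3 /\ (hB false p' %% 2)%Z = false.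
    have [->|np] := eqVneq p' 1; first by apply: (sp true 2); last apply: f1.
    by apply: (sp true 1); [rewrite eq_sym | apply: f1].
  case: b; last exact: f2.
  have [->|np] := eqVneq p 1; first by apply: (sp false 2).
  by apply: (sp false 1); rewrite // eq_sym.
have hW_ok i b f : (hW i b f)%:~R = FW i b f :> 'Z_3 /\ (hW i b f %% 2)%Z = b.
  have [wE bE] := hWE i.
  (* [S] avoids 2 and differs from [f] everywhere, so it links [f] to a hexagon vertex [Base _ 2] in
     two edges. *)
  pose S : {ffun D -> 'I_3} := [ffun d => if f d == 0 then 1 else 0].
  have S2 d : d \in U i -> S d != 2 by move=> _; rewrite ffunE; case: ifP.
  have S_ok b' : (hW i (~~ b') S)%:~R = FW i (~~ b') S :> 'Z_3 /\ (hW i (~~ b') S %% 2)%Z = ~~ b'.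
    have [e1 e2] := hB_ok b' 2.
    by apply: step_color_parity e1 e2; [apply: FB_FW | apply: bE].
  have [e1 e2] := S_ok b.
  have dS : differ (U i) S f by move=> d _; rewrite ffunE; move: (f d); apply: ord3P.
  have := step_color_parity (FW_proper (~~ b) dS) (wE _ _ _ dS) e1 e2.
  by rewrite negbK.
have hL_ok j g : (hL j g)%:~R = F (j, Link g) :> 'Z_3 /\ (hL j g %% 2)%Z = true.
  have [e1 e2] := hB_ok false 1; have := FL_FB j g; rewrite eq_sym => nc.
  by apply: (step_color_parity nc _ e1 e2); rewrite /hL; ring.
have half x y : ~~ gzed x -> ~~ gzed y -> gtri x y -> h y - h x = 1 \/ h y - h x = -1.
  move=> nx ny; suff E : gtri x y -> h y - h x = colstep (F x) (F y).
    by move/E=> ->; apply: colstep_pm.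
  have nb (s s' : bool) : s != s' -> s' = ~~ s by case: s s' => [] [].
  move: x y nx ny => [i [[[[s f]|g]|[s p]]|l]] [j [[[[s' f']|g']|[s' p']]|l']] nx ny;
    rewrite /gtri /h /= ?andbF // => hxy.
  - case/and3P: hxy => /eqP ij /nb -> /forallP ff; subst j.
    have [wE _] := hWE i; apply: wE => d dU; by have /implyP/(_ dU) := ff d.
  - case/andP: hxy => /negbTE -> ; case e: (pr j i) => [r|//] /forallP ff.
    (* The link vertex imitates [G], which avoids 1: the link, [Base false 1], [G] and [f'] form a
       4-cycle. *)
    pose G : {ffun D -> 'I_3} := [ffun d => if r d == g then 0 else 2].
    have [wE bE] := hWE j.
    have dG : differ (U j) G f'.
      by move=> d dU; rewrite ffunE eq_sym; have /implyP/(_ dU) := ff d.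
    have G1 d : d \in U j -> G d != 1 by move=> _; rewrite ffunE; case: ifP.
    apply: (@sum_fit _ (hB false 1) (hW j true G) _ _ (FB false 1) (FW j true G)).
    + exact: FL_FB.
    + exact: (@FB_FW j false).
    + exact: (@FW_proper j true).
    + by apply: (FL_FW e) => d dU; have /implyP/(_ dU) := ff d.
    + by apply: fitC; [rewrite eq_sym FL_FB | rewrite /hL; ring].
    + exact: (bE false).
    + exact: (wE true).
  - case/and3P: hxy => /eqP -> /negbTE -> /eqP ->; rewrite eqxx.
    by apply: fitC; [rewrite eq_sym FL_FB | rewrite /hL; ring].
  - case/and3P: hxy => /eqP oi /nb -> /forallP ff; subst i; rewrite eqxx.
    have [_ bE] := hWE j; apply: bE => d dU; by have /implyP/(_ dU) := ff d.
  - case/and4P: hxy => /eqP -> /eqP -> /nb -> pq; rewrite !eqxx; exact: hBE.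
  - by move: nx; rewrite /gzed /= hxy.
  - by move: nx; rewrite /gzed /= hxy.
  - by move: nx; rewrite /gzed /= hxy.
  - by case/andP: hxy => ho; move: nx; rewrite /gzed /= ho.
exists h => x nx.
have [e1 e2] : (h x)%:~R = F x :> 'Z_3 /\ (h x %% 2)%Z = gside x.
  move: x nx => [i [[[[s f]|g]|[s p]]|l]] nx; rewrite /h /gside /=.
  - exact: hW_ok.
  - exact: hL_ok.
  - by case: eqP => [->|_]; [apply: hB_ok | apply: dummyE].
  - exact: dummyE.
split=> // y ny /orP[/half|/half]; first exact.
by move=> /(_ ny nx); lia.
Qed.

End Unwound.
End Coloring.
End Gadget.

(** With [n = 0] this gives the colouring whose classes are singletons but for the two sides, with
    [n = 1] a colouring that leaves one colour spare. *)
Definition two_sided (n m : nat) (t : 'I_m + bool) : 'I_(n.+2 + m) :=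
  match t with inl i => rshift n.+2 i | inr b => lshift m (inord b) end.

Lemma two_sided_inj n m : injective (@two_sided n m).
Proof.
move=> [i|b] [j|b'] /=.
- by move/rshift_inj=> ->.
- by move/eqP; rewrite eq_rlshift.
- by move/eqP; rewrite eq_lrshift.
- by move/lshift_inj/(congr1 (@nat_of_ord _)); rewrite !inordK; case: b b' => [] [].
Qed.

Lemma class_coloring_proper k (G : graph) (T : finType) (cl : G -> T) (l : T -> 'I_k) :
  (forall x y, adj x y -> cl x != cl y) -> injective l -> proper (class_coloring cl l).
Proof. by move=> h il; apply/coloringP=> x y /h; rewrite !ffunE (inj_eq il). Qed.

Lemma gadget_adjE (I D Gam : finType) (m : nat) (o : I) (U : I -> {set D})
    (pr : I -> I -> option (D -> Gam)) (i j : I) (k k' : kind D Gam m) :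
  @adj (gadget m o U pr) (i, k) (j, k') =
  half_adj (i == o) (j == o) (i == j) (U i) (U j) (pr j i) k k' ||
  half_adj (j == o) (i == o) (j == i) (U j) (U i) (pr i j) k' k.
Proof. by []. Qed.

(** * Colourings of the gadget and its mixing criterion *)

Section GadgetMixing.
Variables (I D Gam : finType) (m : nat) (o : I).
Variables (U : I -> {set D}) (pr : I -> I -> option (D -> Gam)).
Let G : graph := @gadget I D Gam m o U pr.
Let zed : G -> option 'I_m := @gzed I D Gam m o.
Let side : G -> bool := @gside I D Gam m.
Let cls (x : G) : 'I_m + bool := vclass zed side x.

Let cls_adj (x y : G) : adj x y -> cls x != cls y.
Proof. by apply: vclass_adj; [apply: gzed_inj | apply: gside_adj]. Qed.

Lemma gadget_two_sided n : proper (class_coloring cls (@two_sided n m)).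
Proof. by apply: class_coloring_proper; [apply: cls_adj | apply: two_sided_inj]. Qed.

Lemma gadget_colorable : colorable m.+3 G.
Proof. by eexists; apply: (gadget_two_sided 1). Qed.

Lemma gadget_singletons : singletons_but_two m.+2 G.
Proof.
exists (class_coloring cls (@two_sided 0 m)); split; first exact: gadget_two_sided.
apply: leq_trans (_ : #|[set (lshift m (inord (b : bool) : 'I_2) : 'I_(2 + m))
  | b in [set: bool]]| <= 2); last first.
  by rewrite (leq_trans (leq_imset_card _ _)) // cardsT card_bool.
apply/subset_leq_card/subsetP=> i; rewrite inE.
case: (@split_ordP 2 m i) => [j -> _|l ->].
  have -> : j = inord ((j : nat) == 1) :> 'I_2.
    by apply: val_inj; rewrite /= inordK; case: j => [[|[|]]].
  by apply/imsetP; exists ((j : nat) == 1); rewrite ?inE.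
(* Inactive copies of [Zed l] are coloured by their side, so only the copy at [o] carries the colour
   of [l]. *)
case/negP; rewrite (_ : color_class _ _ = [set ((o, Zed l) : G)]) ?cards1 //.
apply/setP=> x; rewrite !inE ffunE /cls /vclass /two_sided; case E: (zed x) => [l'|].
  apply/eqP/eqP => [/(@rshift_inj 2 m l' l) e|e].
    by subst l'; apply: gzed_inj E _; rewrite /gzed /= eqxx.
  by move: E; rewrite e /zed /gzed /= eqxx => -[->].
apply/eqP/eqP=> [e|e]; first by have := @eq_lrshift 2 m (inord (side x)) l; rewrite e eqxx.
by move: E; rewrite e /zed /gzed /= eqxx.
Qed.

Local Open Scope ring_scope.

Section Satisfied.
Variable a : I -> D.
Hypothesis aU : forall i, a i \in U i.
Hypothesis a_compat : forall i i' j r r',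
  pr i j = Some r -> pr i' j = Some r' -> r (a i) = r' (a i').

(** Long codes are evaluated at their dictators, and so is the function that a link vertex imitates;
    by [a_compat] all windows projecting there give the same value. *)
Definition sat_color (x : G) : 'I_3 :=
  match x.2 with
  | Win s f => f (a x.1)
  | Link g => if [exists i, if pr i x.1 is Some r then r (a i) == g else false] then 0 else 2
  | Base s p => p
  | Zed _ => 0
  end.

Definition sat_coloring : {ffun G -> 'I_m.+3} :=
  [ffun x => if zed x is Some l then rshift 3 l else lshift m (sat_color x)].

Lemma sat_coloring_proper : proper sat_coloring.
Proof.
have half (x y : G) : @gtri I D Gam m o U pr x y -> ~~ zed x -> ~~ zed y ->
    sat_color x != sat_color y.
  move: x y => [i [[[[s f]|g]|[s p]]|l]] [j [[[[s' f']|g']|[s' p']]|l']] + nx ny;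
    rewrite /gtri /sat_color /= ?andbF //.
  - by case/and3P=> /eqP <- _ /forallP/(_ (a i)); rewrite aU.
  - case/andP=> _; case e: (pr j i) => [r|//] /forallP/(_ (a j)); rewrite aU /= eq_sym.
    suff -> : [exists i0, if pr i0 i is Some r0 then r0 (a i0) == g else false] =
      (r (a j) == g) by [].
    apply/existsP/idP=> [[i0]|h]; last by exists j; rewrite e.
    by case e0: (pr i0 i) => [r0|//] /eqP <-; rewrite (a_compat e e0).
  - by case/and3P=> _ _ /eqP ->; case: ifP.
  - by case/and3P=> _ _ /forallP/(_ (a j)); rewrite aU /= eq_sym.
  - by case/and4P.
  - by move=> h; move: nx; rewrite /zed /gzed /= h.
  - by move=> h; move: nx; rewrite /zed /gzed /= h.
  - by move=> h; move: nx; rewrite /zed /gzed /= h.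
  - by case/andP=> h; move: nx; rewrite /zed /gzed /= h.
apply/coloringP=> x y xy; rewrite !ffunE.
have nxy : x != y by apply: contraTneq xy => ->; rewrite adj_irr.
case ex: (zed x) => [l|]; case ey: (zed y) => [l'|].
- apply: contraNneq nxy => /(@rshift_inj 3 m l l') e; subst l'.
  by rewrite (gzed_inj ex ey).
- by apply/eqP=> /(congr1 (@nat_of_ord _)) /=; have := ltn_ord (sat_color y); lia.
- by apply/eqP=> /(congr1 (@nat_of_ord _)) /=; have := ltn_ord (sat_color x); lia.
suff h : sat_color x != sat_color y.
  by apply: contraNneq h => /(congr1 (@nat_of_ord _)) /= e; apply/eqP/val_inj.
case/orP: xy => h; first by apply: half; rewrite ?ex ?ey.
by rewrite eq_sym; apply: half; rewrite ?ex ?ey.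
Qed.

(* The triangle-coloured base and the dominating vertices show every colour but its own
   to each of their members, so none of them is ever recoloured. *)
Lemma sat_frozen (c : {ffun G -> 'I_m.+3}) : connect (@rstep _ G) sat_coloring c ->
  forall x : G, (if x.2 is Base _ _ then x.1 == o else isSome (zed x)) -> c x = sat_coloring x.
Proof.
pose core (x : G) := if x.2 is Base _ _ then x.1 == o else isSome (zed x).
apply: (@frozen_core _ G core) => d v /coloringP pd vc keep.
case: (@split_ordP 3 m (d v)) => [p dp|l dl].
  have ev : sat_coloring v = lshift m p -> d v = sat_coloring v by move=> ->.
  apply: ev; apply/eqP; apply: contraT => nv.
  move: v vc dp keep nv => [i [[[[s0 f]|g]|[s0 q]]|l]] //.
    rewrite {1}/core => /eqP /= ->; rewrite ffunE /zed /gzed /sat_color /= => dp keep.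
    move=> nlq; have {nlq}nq : q != p by apply: contraNneq nlq => ->.
    have := pd (o, Base s0 q) (o, Base (~~ s0) p).
    have -> : adj (g := G) (o, Base s0 q) (o, Base (~~ s0) p).
      by rewrite /adj /= /gadj /gtri /= !eqxx /= nq; case: (s0).
    have nbb : (o, Base (~~ s0) p) != ((o, Base s0 q) : G) by apply/eqP=> -[]; case: (s0).
    rewrite dp (keep _ nbb) /core //=.
    by rewrite ffunE /zed /gzed /sat_color /= eqxx => /(_ isT).
  rewrite {1}/core /zed /gzed /=; case: eqP => // -> _ dp keep _.
  have := pd (o, Zed l) (o, Base false p).
  have -> : adj (g := G) (o, Zed l) (o, Base false p) by rewrite /adj /= /gadj /gtri /= eqxx.
  have nzb : (o, Base false p) != ((o, Zed l) : G) by apply/eqP.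
  rewrite dp (keep _ nzb) /core //=.
  by rewrite ffunE /zed /gzed /sat_color /= eqxx => /(_ isT).
have ez : sat_coloring (o, Zed l) = rshift 3 l by rewrite ffunE /zed /gzed /= eqxx.
have zz : zed (o, Zed l) by rewrite /zed /gzed /= eqxx.
have [vz|nv] := eqVneq v ((o, Zed l) : G); first by rewrite dl vz ez.
have := pd (o, Zed l) v (gzed_adj U pr zz nv).
by rewrite dl keep ?ez ?eqxx //= eq_sym.
Qed.

End Satisfied.

Theorem gadget_mixing : k_mixing m.+3 G <-> ~ @sat I D Gam U pr.
Proof.
split=> [mix [a [aU ac]]|nsat].
  have p1 := @sat_coloring_proper a aU ac.
  have p2 : proper (class_coloring cls (@two_sided 1 m) : {ffun G -> 'I_m.+3}).
    exact: gadget_two_sided.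
  have conn : connect (@rstep _ G) (sat_coloring a) (class_coloring cls (@two_sided 1 m)).
    exact: rstep_k_mixing.
  have := sat_frozen conn (x := (o, Base false 1)); rewrite /= eqxx => /(_ isT).
  rewrite !ffunE /cls /vclass /zed /gzed /sat_color /=.
  by move/(congr1 (@nat_of_ord _)); rewrite /= inordK.
apply: (@height_mixing m G zed side).
- exact: gzed_inj.
- exact: gzed_surj.
- exact: gzed_adj.
- exact: gside_adj.
move=> tau c F /coloringP pc ti cF.
have F_adj (x y : G) : adj x y -> ~~ zed x -> ~~ zed y -> F x != F y.
  by move=> /pc + nx ny; rewrite !cF // (inj_eq ti).
have [/forallP eqB|] := boolP [forall p, F (o, Base false p) == F (o, Base true p)]; last first.
  by rewrite negb_forall => /existsP[p np]; apply: (gadget_height F_adj np).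
case: nsat.
(* When opposite hexagon vertices always agree, [s] is a permutation of the colours; undoing it
   gives [Base b p] the colour [p]. *)
pose s p := F (o, Base false p).
have s_inj : injective s.
  move=> p q e; apply/eqP; apply: contraT => pq.
  have := F_adj (o, Base false p) (o, Base true q).
  rewrite /adj /= /gadj /gtri /= !eqxx pq -(eqP (eqB q)) -/(s p) -/(s q) e eqxx.
  by move=> /(_ isT isT isT).
apply: (@rainbow_sat I D Gam m o U pr (fun x => invF s_inj (F x))).
  by move=> x y xy nx ny; rewrite (inj_eq (can_inj (f_invF s_inj))); apply: F_adj.
by move=> b p; rewrite -[RHS](invF_f s_inj); congr invF; case: b; rewrite // -(eqP (eqB p)).
Qed.

End GadgetMixing.

(** * Tableaux of computations *)

Definition mark (k : nat) (lt5 : k < 5) : cell 'I_5 := Some (inr (Ordinal lt5)).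

Lemma mark_eqE :
  (forall k l (hk : k < 5) (hl : l < 5), (mark hk == mark hl) = (k == l)) *
  (forall k b (hk : k < 5), ((Some (inl b) : cell 'I_5) == mark hk) = false) *
  (forall k (hk : k < 5), ((None : cell 'I_5) == mark hk) = false).
Proof. by []. Qed.

Notation Fst := (@mark 0 isT).
Notation Blk := (@mark 1 isT).
Notation Org := (@mark 2 isT).
Notation Gss := (@mark 3 isT).
Notation Lst := (@mark 4 isT).
Notation Bit b := (Some (inl b)).

(* The marks around the origin of a difference tape: it reads [Neg], [Nul], [Pos] at
   -1, 0, 1 and is blank elsewhere. *)
Notation Neg := (@mark 0 isT) (only parsing).
Notation Nul := (@mark 1 isT) (only parsing).
Notation Pos := (@mark 2 isT) (only parsing).

Definition dmark (z : int) : cell 'I_5 :=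
  (if z == -1 then Neg else if z == 0 then Nul else if z == 1 then Pos else None)%R.

Definition dopp (s : cell 'I_5) : cell 'I_5 :=
  if s == Neg then Pos else if s == Pos then Neg else s.

Lemma dmarkN z : dmark (- z)%R = dopp (dmark z).
Proof.
have [->|n1] := eqVneq z 1%R; first by [].
have [->|n0] := eqVneq z 0%R; first by [].
have [->|nm] := eqVneq z (-1)%R; first by [].
rewrite /dmark !ifN //; lia.
Qed.

(* The ruler labels the positions of a tableau row: an input [Bit], a cell [Gss] holding a
   guessed bit or a blank, or a blank; [Org] is the position just before the input, and
   [Fst] and [Lst] are the two ends. It also labels the rows, by [Fst] and [Lst] only. *)
Section Ruler.
Variables (x : word) (Q B : nat).

Definition prefix_word := pair_word x [::].

Definition ruler_tail : seq (cell 'I_5) :=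
  nseq B Blk ++ Org :: [seq Bit b | b <- prefix_word] ++ nseq Q Gss ++ nseq B Blk ++ [:: Lst].
Definition ruler := Fst :: ruler_tail.
Definition width := (size ruler_tail).+1.

Lemma widthE : width = B + 2 + size prefix_word + Q + B + 1.
Proof.
rewrite /width /ruler_tail; move: prefix_word => pw.
by rewrite size_cat /= !size_cat size_map !size_nseq /=; lia.
Qed.

Lemma rulerE p : nth None ruler p =
  if p == 0 then Fst else if p < B + 1 then Blk else if p == B + 1 then Org else
  if p < B + 2 + size prefix_word then Bit (nth false prefix_word (p - (B + 2))) else
  if p < B + 2 + size prefix_word + Q then Gss else
  if p < B + 2 + size prefix_word + Q + B then Blk else
  if p == width.-1 then Lst else None.
Proof.
rewrite widthE /ruler /ruler_tail; move: prefix_word => pw; case: p => [//|p] /=.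
rewrite nth_cat size_nseq nth_nseq addn1 ltnS; case: ltnP => // lp.
rewrite eqSS; case: eqP => [->|np]; first by rewrite subnn.
have -> : p - B = (p - B.+1).+1 by lia.
rewrite /= nth_cat size_map; case: ltnP => lp2.
  rewrite (nth_map false) // ifT; last by lia.
  by congr (Bit (nth _ _ _)); lia.
rewrite ifF; last by lia.
rewrite nth_cat size_nseq nth_nseq; case: ltnP => lp3; first by rewrite ifT //; lia.
rewrite ifF; last by lia.
rewrite nth_cat size_nseq nth_nseq; case: ltnP => lp4; first by rewrite ifT //; lia.
rewrite ifF; last by lia.
case: eqP => [e|ne]; last by rewrite nth_default //=; lia.
by rewrite (_ : _ - _ = 0) //; lia.
Qed.

Lemma pair_wordE w : pair_word x w = prefix_word ++ w.
Proof. by rewrite /prefix_word /pair_word -catA. Qed.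

Lemma size_prefix_word : size prefix_word = 2 * size x + 1.
Proof. by rewrite /prefix_word /pair_word size_cat /=; elim: x => //= b s; lia. Qed.

End Ruler.

Lemma guessed_word (A : Type) (s : seq (option (bool + A))) :
  (forall k, k < size s -> if nth None s k is Some (inr _) then false else true) ->
  (forall k, k.+1 < size s -> ~~ nth None s k -> ~~ nth None s k.+1) ->
  exists2 w : word, size w <= size s & forall k, omap inl (onth w k) = nth None s k.
Proof.
elim: s => [|[[b|c]|] s IH] bits mono.
- by exists [::] => // k; rewrite onth0n nth_nil.
- have [|k kl|w sw wE] := IH; first by move=> k; apply: (bits k.+1).
    exact: (mono k.+1).
  by exists (b :: w) => // -[|k] //=; apply: wE.
- by have := bits 0 isT.
exists [::] => // k; rewrite onth0n; apply/esym.
have none j : ~~ nth None (None :: s) j.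
  elim: j => // j IHj; have [lj|lj] := ltnP j.+1 (size (None :: s)); first exact: mono.
  by rewrite nth_default.
by case: nth (none k).
Qed.

Section Tableau.
Variables (M : machine).
Let e := (extra_tapes M).+1.

(* One tableau entry: the state and the scanned symbols of the row, repeated in each of its
   entries, then for every tape the symbol at this position and whether the head is here. *)
Definition site : finType :=
  ((state M * {ffun 'I_e -> cell (work M)}) * {ffun 'I_e -> cell (work M) * bool})%type.
Definition window : finType := (site * site * site * site)%type.

Definition wleft (d : window) := d.1.1.1.
Definition wcenter (d : window) := d.1.1.2.
Definition wright (d : window) := d.1.2.
Definition wnext (d : window) := d.2.

Definition st (g : site) := g.1.1.
Definition scan (g : site) := g.1.2.
Definition sym (g : site) j := (g.2 j).1.
Definition here (g : site) j := (g.2 j).2.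

(** The move is known at every entry, as it depends on data repeated along the row. A head moving
    left arrives from the right neighbour. *)
Definition evolves (l c r n : site) : bool :=
  match trans (st c) (scan c) with
  | Some (q, w, mv) => (st n == q) && [forall j, n.2 j ==
      (if here c j then w j else sym c j,
       match mv j with Lft => here r j | Stay => here c j | Rgt => here l j end)]
  | None => (st n == st c) && (n.2 == c.2)
  end.

(* Heads start just to the right of [Org], so they are checked on the right neighbour. *)
Definition starts (cp : cell 'I_5) (c r : site) : bool :=
  [&& st c == start M, [forall j, here r j == (cp == Org)],
      (cp == Fst) ==> [forall j, ~~ here c j],
      [forall j, (j != ord0) ==> (sym c j == None)] &
      match cp with
      | Bit b => sym c ord0 == Bit b
      | _ => if cp == Gss then
               (if sym c ord0 is Some (inr _) then false else true) &&
               ((sym c ord0 == None) ==> (sym r ord0 == None))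
             else sym c ord0 == None
      end].

(** The output must be the one-letter word [true]. The position after [Org] is cell 0, hence the
    check on the right neighbour; [Fst] has no left neighbour and checks itself too. *)
Definition accepts (cp : cell 'I_5) (c r : site) : bool :=
  [&& ~~ trans (st c) (scan c),
      sym r ord_max == (if cp == Org then Bit true else None) &
      (cp == Fst) ==> (sym c ord_max == None)].

(** At an end of a row the outer neighbour is shared with no other window; forbidding heads there
    keeps them from entering from outside. *)
Definition allowed (ct cp : cell 'I_5) : {set window} :=
  [set d | let: (l, c, r, n) := d in
    [&& l.1 == c.1, r.1 == c.1,
        (cp == Fst) ==> [forall j, ~~ here l j],
        (cp == Lst) ==> [forall j, ~~ here r j],
        [forall j, here c j ==> (scan c j == sym c j)],
        evolves l c r n,
        (ct == Fst) ==> starts cp c r & (ct == Lst) ==> accepts cp c r]].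

Lemma allowedE l c r n ct cp : ((l, c, r, n) \in allowed ct cp) =
  [&& l.1 == c.1, r.1 == c.1,
      (cp == Fst) ==> [forall j, ~~ here l j],
      (cp == Lst) ==> [forall j, ~~ here r j],
      [forall j, here c j ==> (scan c j == sym c j)],
      evolves l c r n,
      (ct == Fst) ==> starts cp c r & (ct == Lst) ==> accepts cp c r].
Proof. by rewrite inE. Qed.

(** A grid index names both a window and a tableau entry: a window projects to the four entries it
    covers, given by the differences of row and of position. *)
Definition overlap (mt mp : cell 'I_5) : option (window -> site) :=
  if mt == Nul then
    if mp == Neg then Some wleft else if mp == Nul then Some wcenter
    else if mp == Pos then Some wright else None
  else if (mt == Pos) && (mp == Nul) then Some wnext else None.

Variables (x : word) (Q B : nat) (V : word -> word).
Hypothesis V_time : forall w, size w <= Q ->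
  outputs_within M (pair_word x w) (V (pair_word x w)) B.

Let W := width x Q B.
Let rul := nth None (ruler x Q B).
Definition grid : finType := ('I_W * 'I_W)%type.

Definition grid_allowed (i : grid) := allowed (rul i.1) (rul i.2).
Definition grid_overlap (i j : grid) :=
  overlap (dmark (j.1%:Z - i.1%:Z)%R) (dmark (j.2%:Z - i.2%:Z)%R).

Let ruler_Fst p : (rul p == Fst) = (p == 0).
Proof. rewrite /rul rulerE; do ! case: ifP => ?; rewrite ?mark_eqE //; lia. Qed.

Let ruler_Org p : (rul p == Org) = (p == B + 1).
Proof. rewrite /rul rulerE; do ! case: ifP => ?; rewrite ?mark_eqE //; lia. Qed.

Let ruler_Lst p : (rul p == Lst) = (p == W.-1).
Proof.
rewrite /rul rulerE; have := widthE x Q B; rewrite -/W.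
by do ! case: ifP => ?; rewrite ?mark_eqE //; lia.
Qed.

Section Runs.
Variable w : word.
Hypothesis size_w : size w <= Q.
Let conf t := run M (pair_word x w) t.

Lemma conf_step t : conf t.+1 = step (conf t). Proof. by []. Qed.

Lemma conf_stable t : B <= t -> conf t = conf B.
Proof.
move=> /subnK <-; elim: (t - B) => // n IH; rewrite addSn conf_step IH.
by have [hB _] := V_time size_w; rewrite /step hB.
Qed.

(** A head moves at most one cell per step and rests from time [B] on; this is why the ruler has [B]
    blanks on either side. *)
Lemma head_bound t j : (`|head (conf t) j| <= B)%N.
Proof.
have time u : (`|head (conf u) j| <= u)%N.
  elim: u => [|u IH] //; rewrite conf_step /step.
  case: next => [[[q v] mv]|] /=; last by lia.
  by case: (mv j) => /=; lia.
have [tB|/ltnW Bt] := leqP t B; first exact: leq_trans (time t) tB.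
by rewrite conf_stable.
Qed.

Definition site_at t (z : int) : site :=
  ((cstate (conf t), [ffun j => tape (conf t) j (head (conf t) j)]),
   [ffun j => (tape (conf t) j z, head (conf t) j == z)]).

Lemma evolves_run t z :
  evolves (site_at t (z - 1)%R) (site_at t z) (site_at t (z + 1)%R) (site_at t.+1 z).
Proof.
rewrite /evolves /site_at conf_step; move: (conf t) => c; rewrite /st /scan /= /step /next.
case: trans => [[[q v] mv]|] /=; last by rewrite !eqxx.
rewrite eqxx; apply/forallP=> j; rewrite /sym /here !ffunE /= [z == _]eq_sym.
by apply/eqP; congr (_, _); case: (mv j) => /=; apply/eqP/eqP; lia.
Qed.

Lemma tape0E z : word_tape (work M) (pair_word x w) z =
  match z with
  | Posz p => if p < size (prefix_word x) then Bit (nth false (prefix_word x) p)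
              else omap inl (onth w (p - size (prefix_word x)))
  | Negz _ => None
  end.
Proof.
case: z => // p; rewrite pair_wordE /= onth_cat; case: ltnP => // lp.
by rewrite onthE (nth_map false).
Qed.

End Runs.

Lemma run_sat w : size w <= Q -> V (pair_word x w) = [:: true] ->
  sat grid_allowed grid_overlap.
Proof.
move=> sw acc; pose z (p : nat) : int := (p%:Z - (B + 2)%N%:Z)%R.
have [halt tapeE] := V_time sw; rewrite acc in tapeE.
(* Tape cell 0 is in column [B + 2], just after [Org], whence the shift in [z]. Each window is
   filled in from the run. *)
exists (fun i : grid => (site_at w i.1 (z i.2 - 1)%R, site_at w i.1 (z i.2),
                  site_at w i.1 (z i.2 + 1)%R, site_at w i.1.+1 (z i.2))).
split=> [i|i i' j r r'].
  rewrite /grid_allowed allowedE evolves_run // !ruler_Fst !ruler_Lst.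
  move: i.1 i.2 => t p; apply/and3P; split; [exact: eqxx | exact: eqxx |].
  have ltp := ltn_ord p; have ltt := ltn_ord t; have wE := widthE x Q B; rewrite -/W in wE ltp ltt.
  rewrite [true && _]andTb; apply/and5P; split.
  - apply/implyP=> /eqP p0; apply/forallP=> j; rewrite /here ffunE /= /z p0.
    by have := head_bound sw t j; lia.
  - apply/implyP=> /eqP pW; apply/forallP=> j; rewrite /here ffunE /= /z pW.
    have := head_bound sw t j; lia.
  - by apply/forallP=> j; apply/implyP; rewrite /here /scan /sym !ffunE /= => /eqP ->.
  - apply/implyP=> /eqP ->; rewrite /starts !ruler_Fst !ruler_Org /st /= eqxx /=.
    apply/and4P; split.
    + by apply/forallP=> j; rewrite /here ffunE /= /z; apply/eqP; apply/eqP/eqP; lia.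
    + by apply/implyP=> /eqP p0; apply/forallP=> j; rewrite /here ffunE /= /z p0; lia.
    + by apply/forallP=> j; apply/implyP=> /negbTE nj; rewrite /sym ffunE /= nj.
    rewrite /sym !ffunE /= /rul rulerE !tape0E.
    have zneg : (p < B + 2)%N -> exists k, z p = Negz k.
      by move=> pB; exists (B + 1 - p)%N; rewrite /z; lia.
    have zpos : (B + 2 <= p)%N -> z p = Posz (p - (B + 2))%N /\ (z p + 1)%R = Posz (p - (B + 2)).+1.
      by rewrite /z; lia.
    case: eqP => [p0|np0]; first by have [|k ->] := zneg; rewrite ?p0 //=; lia.
    case: ltnP => lp1; first by have [|k ->] := zneg; rewrite //=; lia.
    case: eqP => [p1|np1]; first by have [|k ->] := zneg; rewrite //=; lia.
    case: zpos => [|zp zp1]; first by lia.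
    rewrite zp1 zp.
    case: ltnP => lp2; first by rewrite ifT //; lia.
    have blank k : (size w <= k)%N -> onth w k = None.
      by exact: onth_default.
    rewrite !(@ifF _ (_ < size _)%N); try lia.
    case: ltnP => lp3 /=.
      case ew: (onth w _) => [b|] //=; rewrite blank //.
      by have := onthNE w (p - (B + 2) - size (prefix_word x)); rewrite ew /=; lia.
    case: ltnP => lp4 /=; first by rewrite blank //; lia.
    by case: eqP => _; rewrite blank //; lia.
  apply/implyP=> /eqP tW.
  have tB : run M (pair_word x w) t = run M (pair_word x w) B.
    by apply: conf_stable => //; lia.
  rewrite /accepts /site_at tB /st /scan /sym !ruler_Org ruler_Fst !ffunE /=.
  move: halt; rewrite /halted /next /= => ->; rewrite !tapeE /=.
  have zE : (p == B + 1 :> nat) = (z p + 1 == 0)%R by rewrite /z; apply/eqP/eqP; lia.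
  rewrite zE; apply/andP; split.
    by have [->|] := eqVneq (z p + 1)%R 0%R; last case: (z p + 1)%R => [[|[|k]]|k].
  by apply/implyP=> /eqP p0; rewrite (_ : z p = Negz (B + 1)%N) // /z p0; lia.
have overE (i0 : grid) r0 : grid_overlap i0 j = Some r0 ->
    r0 (site_at w i0.1 (z i0.2 - 1)%R, site_at w i0.1 (z i0.2),
        site_at w i0.1 (z i0.2 + 1)%R, site_at w i0.1.+1 (z i0.2)) = site_at w j.1 (z j.2).
  rewrite /grid_overlap /overlap /dmark /z.
  move: i0.1 i0.2 j.1 j.2 => t p t' p'.
  have [et|_] := eqVneq (t'%:Z - t%:Z)%R (-1)%R => //.
  have [et|_] := eqVneq (t'%:Z - t%:Z)%R 0%R.
    have -> : t = t' by apply: ord_inj; lia.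
    have [ep|_] := eqVneq (p'%:Z - p%:Z)%R (-1)%R; first by move=> [<-]; congr site_at; lia.
    have [ep|_] := eqVneq (p'%:Z - p%:Z)%R 0%R; first by move=> [<-]; congr site_at; lia.
    by have [ep|_] := eqVneq (p'%:Z - p%:Z)%R 1%R => // -[<-]; congr site_at; lia.
  have [et|_] := eqVneq (t'%:Z - t%:Z)%R 1%R => //.
  have [ep|_] := eqVneq (p'%:Z - p%:Z)%R (-1)%R => //.
  have [ep|_] := eqVneq (p'%:Z - p%:Z)%R 0%R.
    by move=> [<-]; congr site_at; lia.
  by have [ep|_] := eqVneq (p'%:Z - p%:Z)%R 1%R.
by move=> /overE -> /overE ->.
Qed.

Lemma sat_run : sat grid_allowed grid_overlap ->
  exists2 w, size w <= Q & V (pair_word x w) = [:: true].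
Proof.
case=> a [aU ac]; pose z (p : nat) : int := (p%:Z - (B + 2)%N%:Z)%R.
have wE := widthE x Q B; rewrite -/W in wE.
have N0 := size_prefix_word x; set N := size _ in wE N0.
pose io t : 'I_W := @inord (size (ruler_tail x Q B)) t.
have ioK t : t < W -> io t = t :> nat by move=> tW; rewrite /io inordK.
pose b t p : site := wcenter (a (io t, io p)).
have win t p : t < W -> p < W -> exists l r n,
    [/\ (l, b t p, r, n) \in allowed (rul t) (rul p), (0 < p -> l = b t p.-1),
        (p.+1 < W -> r = b t p.+1) & (t.+1 < W -> n = b t.+1 p)].
  move=> tW pW; have := aU (io t, io p); have compat := ac (io t, io p).
  rewrite /grid_allowed /b /= !ioK //; move: (a _) compat => [[[l c] r] n] compat al.
  exists l, r, n; split=> // [p0|p1|t1].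
  - have := compat (io t, io p.-1) (io t, io p.-1) wleft wcenter.
    rewrite /grid_overlap /= !subrr !ioK //; last lia.
    by rewrite (_ : (_ - _)%R = (-1)%R); [move=> /(_ erefl erefl) | lia].
  - have := compat (io t, io p.+1) (io t, io p.+1) wright wcenter.
    rewrite /grid_overlap /= !subrr !ioK //.
    by rewrite (_ : (_ - _)%R = 1%R); [move=> /(_ erefl erefl) | lia].
  - have := compat (io t.+1, io p) (io t.+1, io p) wnext wcenter.
    rewrite /grid_overlap /= !subrr !ioK //.
    by rewrite (_ : (_ - _)%R = 1%R); [move=> /(_ erefl erefl) | lia].
have glob t p : t < W -> p < W -> (b t p).1 = (b t 0).1.
  move=> tW; elim: p => // p IH pW; rewrite -IH; last lia.
  have [l [r [n []]]] := win t p.+1 tW pW.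
  by rewrite allowedE => /and3P[/eqP <- _ _] ->.
(* The certificate is read off the guessed cells of row 0, which follow the prefix. *)
pose s := [seq sym (b 0 (B + 2 + N + k)) ord0 | k <- iota 0 Q].
have sE k : k < Q -> nth None s k = sym (b 0 (B + 2 + N + k)) ord0.
  by move=> kQ; rewrite (nth_map 0) ?size_iota // nth_iota.
have ss : size s = Q by rewrite size_map size_iota.
have start p : p < W -> exists l r : site, [/\ (0 < p -> l = b 0 p.-1), (p.+1 < W -> r = b 0 p.+1)
    & starts (rul p) (b 0 p) r].
  move=> pW; have [//|l [r [n [al hl hr _]]]] := win 0 p _ pW; exists l, r; split=> //.
  by move: al; rewrite allowedE ruler_Fst => /and5P[_ _ _ _ /and4P[_ _ + _]].
have gss k : k < Q -> rul (B + 2 + N + k) = Gss.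
  by move=> kQ; rewrite /rul rulerE; do ! case: ifP => //; lia.
have [k|k|w sw wE'] := @guessed_word (work M) s.
- rewrite ss => kQ; rewrite sE //; have [|l [r [_ _]]] := start (B + 2 + N + k); first lia.
  by rewrite gss // => /and5P[_ _ _ _ /andP[]].
- rewrite ss => kQ; rewrite !sE //; last lia.
  have [|l [r [_ hr]]] := start (B + 2 + N + k); first lia.
  rewrite gss //; last lia.
  case/and5P=> _ _ _ _ /andP[_]; rewrite hr -?addnS; last lia.
  by case: (sym (b 0 (B + 2 + N + k)) ord0) => // /eqP ->.
rewrite ss in sw; exists w => //.
pose conf t := run M (pair_word x w) t.
(* By induction on the rows, the centres of the windows reproduce the run on [w]. *)
pose good t := forall p, p < W -> st (b t p) = cstate (conf t) /\
  forall j, sym (b t p) j = tape (conf t) j (z p) /\ here (b t p) j = (head (conf t) j == z p).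
have scanE t p : t < W -> good t -> p < W ->
    scan (b t p) = [ffun j => tape (conf t) j (head (conf t) j)].
  move=> tW gt pW; apply/ffunP=> j; rewrite ffunE /scan glob //.
  have hb := head_bound sw t j; rewrite -/(conf t) in hb.
  (* Column [p'] is the one under the head. Its window compares the scanned symbol with the one
     written there, and [glob] spreads the result along the row. *)
  pose p' := `|(head (conf t) j + Posz (B + 2))%R|%N.
  have p'W : p' < W by rewrite /p'; lia.
  have zp' : z p' = head (conf t) j by rewrite /z /p'; lia.
  have [l [r [n []]]] := win t p' tW p'W.
  rewrite allowedE => /and5P[_ _ _ _ /and4P[/forallP/(_ j) + _ _ _]] _ _ _.
  have [_ /(_ j)[-> ->]] := gt p' p'W.
  by rewrite zp' eqxx /= /scan glob // => /eqP.
have good0 : good 0.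
  move=> p pW; have [l [r [hl hr sp]]] := start p pW.
  case/and5P: (sp) => /eqP st0 _ /implyP noh /forallP other first0; split=> // j; split.
    have [->|nj] := eqVneq j ord0; last first.
      by have := other j; rewrite nj /= => /eqP ->; rewrite (negbTE nj).
    rewrite /conf /run /= tape0E; move: first0; rewrite /rul rulerE -/N.
    have zneg : (p < B + 2)%N -> exists k, z p = Negz k.
      by move=> pB; exists (B + 1 - p)%N; rewrite /z; lia.
    have zpos : (B + 2 <= p)%N -> z p = Posz (p - (B + 2))%N by rewrite /z; lia.
    case: eqP => [p0|np0]; first by have [|k ->] := zneg; [lia | move/eqP].
    case: ltnP => lp1; first by have [|k ->] := zneg; [lia | move/eqP].
    case: eqP => [p1|np1]; first by have [|k ->] := zneg; [lia | move/eqP].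
    rewrite zpos; last lia.
    case: ltnP => lp2; first by rewrite ifT; [move/eqP | lia].
    rewrite (@ifF _ (p - (B + 2) < N)); last lia.
    rewrite wE'; case: ltnP => lp3.
      by move=> _; rewrite sE; [congr (sym (b 0 _) _); lia | lia].
    by case: ltnP => lp4; rewrite nth_default ?ss; try lia; [|case: eqP => _]; move/eqP.
  rewrite /conf /run /=.
  have [p0|p0] := posnP p.
    move: noh; rewrite ruler_Fst p0 => /(_ isT)/forallP/(_ j)/negbTE ->.
    by apply/esym/negbTE; rewrite /z; lia.
  have [|l' [r' [_ hr' /and5P[_ /forallP/(_ j) + _ _ _]]]] := start p.-1; first lia.
  rewrite hr' prednK // ruler_Org => /eqP ->; rewrite /z; apply/eqP/eqP; lia.
have goodS t : t.+1 < W -> good t -> good t.+1.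
  move=> tW gt p pW; have tW' := ltnW tW.
  have [l [r [n [al hl hr hn]]]] := win t p tW' pW.
  move: al; rewrite allowedE hn // => /and5P[_ _ nl nr /and4P[_ ev _ _]].
  have [stc symc] := gt p pW; have sc := scanE t p tW' gt pW.
  have hhl j : here l j = (head (conf t) j == z p - 1)%R.
    case: (posnP p) => [p0|p0].
      move: nl; rewrite ruler_Fst p0 => /forallP/(_ j)/negbTE ->.
      by apply/esym/negbTE; have := head_bound sw t j; rewrite /z -/(conf t); lia.
    have [|_ /(_ j)[_]] := gt p.-1; first lia.
    by rewrite hl // => ->; congr (_ == _); rewrite /z; lia.
  have hhr j : here r j = (head (conf t) j == z p + 1)%R.
    have [p1|p1] := ltnP p.+1 W.
      have [//|_ /(_ j)[_]] := gt p.+1.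
      by rewrite hr // => ->; congr (_ == _); rewrite /z; lia.
    have pe : p = W.-1 by lia.
    move: nr; rewrite ruler_Lst pe eqxx => /forallP/(_ j)/negbTE ->.
    by apply/esym/negbTE; have := head_bound sw t j; rewrite /z -/(conf t); lia.
  move: ev; rewrite /evolves stc sc /conf /run iterS -/(run _ _ _) -/(conf t) /step /next.
  case: trans => [[[q v] mv]|] /=; last first.
    by move=> /andP[/eqP -> /eqP en]; split=> // j; rewrite /sym /here en; apply: symc.
  move=> /andP[/eqP -> /forallP en]; split=> // j; rewrite /sym /here (eqP (en j)) /=.
  have [-> ->] := symc j; split; first by rewrite eq_sym.
  by case: (mv j) => /=; rewrite ?hhr ?hhl; apply/eqP/eqP; lia.
have good_all t : t < W -> good t.
  by elim: t => [|t IH] tW; [apply: good0 | apply: goodS => //; apply: IH; lia].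
have lastW : W.-1 < W by lia.
have acc p : p.+1 < W -> tape (conf W.-1) ord_max (z p.+1) = if p == B + 1 then Bit true else None.
  move=> pW; have [|l [r [n [al hl hr hn]]]] := win W.-1 p lastW; first lia.
  move: al; rewrite allowedE !ruler_Lst eqxx => /and5P[_ _ _ _ /and4P[_ _ _ /and3P[_ + _]]].
  rewrite hr // ruler_Org => /eqP <-.
  by have [_ /(_ ord_max)[->]] := good_all _ lastW _ pW.
have [_ tapeE] := V_time sw.
have confB : conf W.-1 = run M (pair_word x w) B by apply: conf_stable => //; lia.
(* Cells 0 and 1 determine that the output is the one-letter word. *)
have y0 : word_tape (work M) (V (pair_word x w)) 0 = Bit true.
  rewrite -tapeE -confB; have := acc (B + 1); rewrite eqxx.
  rewrite (_ : z _ = 0%R) => [->//|]; last by rewrite /z; lia.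
  lia.
have y1 : word_tape (work M) (V (pair_word x w)) 1 = None.
  rewrite -tapeE -confB; have := acc (B + 2); rewrite ifF; last lia.
  rewrite (_ : z _ = 1%R) => [->//|]; last by rewrite /z; lia.
  lia.
by case: (V _) y0 y1 => [|[] [|]].
Qed.

End Tableau.

(** * Structured programs for multi-tape machines *)

Section Programs.
Variables (K : nat) (work : finType).
Local Notation tcell := (cell work).

Record store := Store { hd : nat -> int; tp : nat -> int -> tcell }.

Lemma store_eq s s' : hd s =1 hd s' -> (forall i, tp s i =1 tp s' i) -> s = s'.
Proof.
case: s s' => [h t] [h' t'] /= eh et.
have -> : h = h' by apply: functional_extensionality => i; apply: eh.
have -> // : t = t'.
by apply: functional_extensionality => i; apply: functional_extensionality => z; apply: et.
Qed.

Definition scanned (s : store) : nat -> tcell :=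
  fun i => if i <= K then tp s i (hd s i) else None.

(* Tapes beyond [K] do not exist: they are never written and read as blank. *)
Definition action := (nat -> tcell) -> (nat -> tcell) * (nat -> move).

Definition perform (a : action) (s : store) : store :=
  Store (fun i => moved ((a (scanned s)).2 i) (hd s i))
        (fun i p => if (i <= K) && (p == hd s i) then (a (scanned s)).1 i else tp s i p).

Inductive prog :=
  Nop | Act of action | Seq of prog & prog | While of ((nat -> tcell) -> bool) & prog.

(* The costs count the branch instructions that [compile] inserts. *)
Inductive exec : prog -> store -> store -> nat -> Prop :=
| ExecNop s : exec Nop s s 0
| ExecAct a s : exec (Act a) s (perform a s) 1
| ExecSeq p q s s' s'' m n :
    exec p s s' m -> exec q s' s'' n -> exec (Seq p q) s s'' (m + n)
| ExecStop (b : (nat -> tcell) -> bool) p s : ~~ b (scanned s) -> exec (While b p) s s 1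
| ExecLoop (b : (nat -> tcell) -> bool) p s s' s'' m n : b (scanned s) ->
    exec p s s' m -> exec (While b p) s' s'' n -> exec (While b p) s s'' (m + 2 + n).

Inductive instr := IAct of action | IBranch of ((nat -> tcell) -> bool) & nat.

(* [IBranch b l] jumps to the absolute address [l] when [b] holds. *)
Fixpoint compile (o : nat) (p : prog) : seq instr :=
  match p with
  | Nop => [::]
  | Act a => [:: IAct a]
  | Seq p q => let c := compile o p in c ++ compile (o + size c) q
  | While b p => let c := compile o.+1 p in
      IBranch (fun s => ~~ b s) (o + size c).+2 :: rcons c (IBranch xpredT o)
  end.

Section Machine.
Variable code : seq instr.

Definition extend (f : {ffun 'I_K.+1 -> tcell}) : nat -> tcell :=
  fun i => if i <= K then f (inord i) else None.

Definition code_trans (q : 'I_(size code).+1) (f : {ffun 'I_K.+1 -> tcell}) :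
    option ('I_(size code).+1 * {ffun 'I_K.+1 -> tcell} * ('I_K.+1 -> move)) :=
  match onth code q with
  | Some (IAct a) => Some (inord q.+1, [ffun j : 'I_K.+1 => (a (extend f)).1 j],
                           fun j : 'I_K.+1 => (a (extend f)).2 j)
  | Some (IBranch b l) => Some (inord (if b (extend f) then l else q.+1), f, fun _ => Stay)
  | None => None
  end.

Definition code_machine : machine := @Machine K 'I_(size code).+1 work ord0 code_trans.

Definition code_config (q : nat) (s : store) : config code_machine :=
  @Config code_machine (inord q) (fun j : 'I_K.+1 => hd s j) (fun j : 'I_K.+1 => tp s j).

Lemma extend_scan s : extend [ffun j : 'I_K.+1 => tp s j (hd s j)] = scanned s.
Proof.
apply: functional_extensionality => i; rewrite /extend /scanned; case: leqP => // iK.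
by rewrite ffunE inordK.
Qed.

Lemma step_act q a s : q < size code -> onth code q = Some (IAct a) ->
  step (code_config q s) = code_config q.+1 (perform a s).
Proof.
move=> lq ea; rewrite /step /next /= /code_trans inordK ?ltnS ?(ltnW lq) // ea extend_scan.
congr Config; last first.
apply: functional_extensionality => j; apply: functional_extensionality => p.
by rewrite ffunE /= -ltnS ltn_ord.
Qed.

Lemma step_branch q b l s : q < size code -> onth code q = Some (IBranch b l) ->
  step (code_config q s) = code_config (if b (scanned s) then l else q.+1) s.
Proof.
move=> lq eb; rewrite /step /next /= /code_trans inordK ?ltnS ?(ltnW lq) // eb extend_scan.
congr Config; apply: functional_extensionality => j; apply: functional_extensionality => p.
by rewrite ffunE; case: eqP => [->|].
Qed.

(** Jumps are absolute, so the induction runs over code placed at address [size pre] in an arbitrary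
    context. *)
Lemma compile_exec p s s' n : exec p s s' n ->
  forall pre post, code = pre ++ compile (size pre) p ++ post ->
  iter n (@step code_machine) (code_config (size pre) s) =
  code_config (size pre + size (compile (size pre) p)) s'.
Proof.
elim=> {p s s' n} [s|a s|p q s s' s'' m n _ IHp _ IHq|b p s nb|b p s s' s'' m n bs _ IHp _ IHw]
  pre post ec.
- by rewrite addn0.
- rewrite /= (@step_act _ a) ?addn1 // ec ?size_cat /=; first by lia.
  by rewrite onth_cat ltnn subnn.
- rewrite addnC iterD 
    (IHp pre (compile (size pre + size (compile (size pre) p)) q ++ post)); last first.
    by rewrite ec /= -catA.
  rewrite -size_cat (IHq _ post) /=; last by rewrite ec /= size_cat !catA.
  by rewrite !size_cat addnA.
- rewrite /= (@step_branch _ (fun s => ~~ b s) (size pre + size (compile (size pre).+1 p)).+2).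
  + by rewrite nb size_rcons !addnS.
  + by rewrite ec size_cat /=; lia.
  + by rewrite ec onth_cat ltnn subnn.
set c := compile (size pre).+1 p in IHp.
have code_entry : onth code (size pre) = Some (IBranch (fun s => ~~ b s) (size pre + size c).+2).
  by rewrite ec onth_cat ltnn subnn.
have sc : size code = size pre + (size c).+2 + size post.
  by rewrite ec size_cat /= size_cat size_rcons -/c; lia.
have code_exit : onth code (size pre + size c).+1 = Some (IBranch xpredT (size pre)).
  rewrite ec onth_cat ifF; last by lia.
  rewrite (_ : _ - _ = (size c).+1); last by lia.
  by rewrite /= cat_rcons onth_cat ltnn subnn.
rewrite (_ : m + 2 + n = n + (1 + (m + 1))); last by lia.
rewrite !iterD [iter 1 _ (code_config _ s)]/= (step_branch _ _ code_entry) ?sc; last by lia.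
rewrite bs /=.
have := IHp (rcons pre (IBranch (fun s => ~~ b s) (size pre + size c).+2))
  (IBranch xpredT (size pre) :: post).
rewrite size_rcons => ->; last first.
  by rewrite ec cat_rcons /= -/c cat_rcons.
rewrite -/c addSn (step_branch _ _ code_exit) ?sc; last by lia.
by rewrite (IHw pre post ec).
Qed.

Lemma run_exec p c c' n : code = compile 0 p -> exec p c c' n ->
  iter n (@step code_machine) (code_config 0 c) = code_config (size code) c'.
Proof.
move=> ec ex; have := compile_exec ex (pre := [::]) (post := [::]).
by rewrite cats0 /= add0n -ec; apply.
Qed.

Lemma code_halted c : halted (code_config (size code) c).
Proof. by rewrite /halted /next /= /code_trans inordK // onth_default. Qed.

End Machine.
End Programs.

(** * Loops over tapes and their running times *)

Section Loops.
Variables (K : nat) (work : finType).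
Local Notation tcell := (cell work).
Local Notation store := (store work).
Local Notation prog := (prog work).
Implicit Types (s : store) (p q : prog) (g : pred nat).

Definition runs p s s' B := exists2 n, n <= B & exec K p s s' n.

Lemma runs_le p s s' B B' : B <= B' -> runs p s s' B -> runs p s s' B'.
Proof. by move=> le [n ln ex]; exists n => //; apply: leq_trans le. Qed.

Lemma runs_eq p s s' s'' B : runs p s s' B -> s' = s'' -> runs p s s'' B.
Proof. by move=> h <-. Qed.

Lemma runs_seq p q s s' s'' B C : runs p s s' B -> runs q s' s'' C ->
  runs (Seq p q) s s'' (B + C).
Proof.
by move=> [m lm pm] [n ln qn]; exists (m + n); [apply: leq_add | apply: ExecSeq qn].
Qed.

Lemma runs_nop s : runs (Nop work) s s 0.
Proof. by exists 0 => //; apply: ExecNop. Qed.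

Definition displace g (z : int) s : store :=
  Store (fun i => if g i then hd s i + z else hd s i)%R (tp s).

Lemma displaceD g y z s : displace g z (displace g y s) = displace g (y + z)%R s.
Proof. by apply: store_eq => //= i; case: (g i); rewrite ?addrA. Qed.

Lemma displace0 g s : displace g 0 s = s.
Proof. by apply: store_eq => //= i; rewrite addr0 if_same. Qed.

Definition mv_group g (m : move) : prog :=
  Act (fun r : nat -> tcell => (r, fun i => if g i then m else Stay)).

Definition move_int (m : move) : int := moved m 0.

Lemma mv_group_runs g m s : runs (mv_group g m) s (displace g (move_int m) s) 1.
Proof.
exists 1 => //; rewrite (_ : displace _ _ _ = perform K
  (fun r : nat -> tcell => (r, fun i => if g i then m else Stay)) s); first exact: ExecAct.
apply: store_eq => [i|i z] /=; first by case: ifP => // _; rewrite /move_int; case: m => /=; ring.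
by rewrite /scanned; case: leqP => //= iK; case: eqP => [->|].
Qed.

Definition nonblank j : (nat -> tcell) -> bool := fun r => r j.

Definition segment (T : int -> tcell) (l : nat) :=
  forall z : int, (T z : bool) = (0 <= z)%R && (z < l%:Z)%R.

Lemma scanned_segment s j l : j <= K -> segment (tp s j) l ->
  nonblank j (scanned K s) = (0 <= hd s j)%R && (hd s j < l%:Z)%R.
Proof. by move=> jK seg; rewrite /nonblank /scanned jK seg. Qed.

(** The first step enters the word from a head standing just past its end; the scan stops at cell
    -1, whence the last step to the right. *)
Definition back g j := Seq (mv_group g Lft)
  (Seq (While (nonblank j) (mv_group g Lft)) (mv_group g Rgt)).

Lemma back_runs g j s l n : j <= K -> g j -> segment (tp s j) l -> n <= l ->
  hd s j = n -> runs (back g j) s (displace g (- n%:Z)%R s) (3 * n + 3).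
Proof.
move=> jK gj seg nl hj.
have back_while k s' : k <= l -> segment (tp s' j) l -> hd s' j = (k%:Z - 1)%R ->
    runs (While (nonblank j) (mv_group g Lft)) s' (displace g (- k%:Z)%R s') (3 * k + 1).
  elim: k s' => [|k IH] s' kl seg' hk.
    exists 1; rewrite // oppr0 displace0; apply: ExecStop.
    by rewrite (scanned_segment jK seg') hk.
  have [n1 l1 e1] := mv_group_runs g Lft s'.
  have [|n2 l2 e2] := IH (displace g (move_int Lft) s') (ltnW kl) seg'.
    by rewrite /= gj hk /move_int /=; lia.
  exists (n1 + 2 + n2); first by lia.
  apply: ExecLoop e1 _; first by rewrite (scanned_segment jK seg') hk; lia.
  move: e2; rewrite displaceD (_ : move_int Lft + - k%:Z = - k.+1%:Z)%R //.
  by rewrite /move_int /=; lia.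
have h1 := mv_group_runs g Lft s.
have h2 := back_while n (displace g (move_int Lft) s) nl seg.
have h3 := mv_group_runs g Rgt (displace g (- n%:Z)%R (displace g (move_int Lft) s)).
have h := runs_seq h1 (runs_seq (h2 _) h3).
rewrite (_ : displace g (- n%:Z)%R s =
    displace g (move_int Rgt) (displace g (- n%:Z)%R (displace g (move_int Lft) s))).
  by apply: runs_le (h _); rewrite /= ?gj ?hj /move_int /=; lia.
by rewrite !displaceD; congr displace; rewrite /move_int /=; lia.
Qed.

Definition For j body := Seq (While (nonblank j) (Seq body (mv_group (pred1 j) Rgt)))
  (back (pred1 j) j).

(** [A i] is the store before round [i] and [E i] the one after its body. Besides the body, a round
    costs 3 for advancing and branching and 3 for the way back. *)
Lemma for_runs j body l c (A E : nat -> store) : j <= K ->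
  (forall i, i <= l -> hd (A i) j = i /\ segment (tp (A i) j) l) ->
  (forall i, i < l -> runs body (A i) (E i) c) ->
  (forall i, i < l -> displace (pred1 j) 1 (E i) = A i.+1) ->
  runs (For j body) (A 0) (displace (pred1 j) (- l%:Z)%R (A l)) (l * (c + 6) + 4).
Proof.
move=> jK Aj run_body EA.
have loop k : k <= l -> runs (While (nonblank j) (Seq body (mv_group (pred1 j) Rgt)))
    (A (l - k)) (A l) (k * (c + 3) + 1).
  elim: k => [|k IH] kl.
    rewrite subn0; exists 1 => //; apply: ExecStop; have [hj seg] := Aj l (leqnn l).
    by rewrite (scanned_segment jK seg) hj; lia.
  have [n1 l1 e1] := run_body (l - k.+1) ltac:(lia).
  have [n2 l2 e2] := mv_group_runs (pred1 j) Rgt (E (l - k.+1)).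
  have [n3 l3 e3] := IH (ltnW kl).
  exists (n1 + n2 + 2 + n3); first by rewrite mulSn; lia.
  apply: ExecLoop (ExecSeq e1 e2) _.
    have [hj seg] := Aj (l - k.+1) ltac:(lia).
    by rewrite (scanned_segment jK seg) hj; lia.
  have -> : displace (pred1 j) (move_int Rgt) (E (l - k.+1)) = A (l - k).
    by rewrite (_ : move_int Rgt = 1%R) // EA; [congr A; lia | lia].
  exact: e3.
have [hj seg] := Aj l (leqnn l).
have := runs_seq (loop l (leqnn l)) (back_runs (g := pred1 j) jK (eqxx j) seg (leqnn l) hj).
by rewrite subnn => h; apply: runs_le h; lia.
Qed.

Definition seqs := foldr (@Seq work) (Nop work).

Definition cells_tape (w : seq tcell) (z : int) : tcell :=
  match z with Posz n => nth None w n | Negz _ => None end.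

Lemma cells_tape_rcons w c z :
  cells_tape (rcons w c) z = if z == size w then c else cells_tape w z.
Proof.
case: z => [n|n] //=; rewrite nth_rcons eqz_nat; case: ltngtP => // h.
by rewrite nth_default // ltnW.
Qed.

Lemma cells_tape_segment w : all isSome w -> segment (cells_tape w) (size w).
Proof.
move=> /allP aw [n|n]; last by [].
rewrite lez_nat ltz_nat /=; case: ltnP => h; first by rewrite aw ?mem_nth.
by rewrite nth_default.
Qed.

Section Writing.
Variable g : pred nat.

(* All tapes of the group [g] hold the same word [w] and have their heads at its end; the
   other tapes and heads are described by [T] and [H]. *)
Definition writing (T : nat -> int -> tcell) (H : nat -> int) w : store :=
  Store (fun i => if g i then Posz (size w) else H i)
        (fun i => if g i then cells_tape w else T i).

Definition emit (f : (nat -> tcell) -> tcell) : prog :=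
  Act (fun r : nat -> tcell => (fun i => if g i then f r else r i,
                                fun i => if g i then Rgt else Stay)).

Definition read T (H : nat -> int) : nat -> tcell :=
  fun i => if i <= K then (if g i then None else T i (H i)) else None.

Lemma scanned_writing T H w : scanned K (writing T H w) = read T H.
Proof.
apply: functional_extensionality => i; rewrite /scanned /read /=.
by case: ifP => // _; case: ifP => //= _; rewrite nth_default.
Qed.

Hypothesis gK : forall i, g i -> i <= K.

Lemma emit_runs f T H w :
  runs (emit f) (writing T H w) (writing T H (rcons w (f (read T H)))) 1.
Proof.
exists 1 => //; rewrite (_ : writing T H (rcons _ _) = perform K
  (fun r : nat -> tcell => (fun i => if g i then f r else r i,
                            fun i => if g i then Rgt else Stay)) (writing T H w)).
  exact: ExecAct.
apply: store_eq => [i|i z]; rewrite /perform scanned_writing /=.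
  by case: ifP => // _ /=; rewrite size_rcons; lia.
case gi: (g i); first by rewrite gK // cells_tape_rcons.
by rewrite /read gi; case: leqP => //= _; case: eqP => [->|].
Qed.

Lemma emits_runs fs T H w :
  runs (seqs [seq emit f | f <- fs]) (writing T H w)
       (writing T H (w ++ [seq f (read T H) | f <- fs])) (size fs).
Proof.
elim: fs w => [|f fs IH] w; first by rewrite cats0; apply: runs_nop.
by have := runs_seq (emit_runs f T H w) (IH _); rewrite -cats1 -catA.
Qed.

Lemma seqs_runs (A : Type) (ps : seq A) (P : A -> prog) (row : A -> seq tcell) T H w c :
  (forall a w, runs (P a) (writing T H w) (writing T H (w ++ row a)) c) ->
  runs (seqs [seq P a | a <- ps]) (writing T H w)
       (writing T H (w ++ flatten [seq row a | a <- ps])) (size ps * c).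
Proof.
move=> run_P; elim: ps w => [|a ps IH] w; first by rewrite cats0; apply: runs_nop.
by have := runs_seq (run_P a w) (IH _); rewrite -catA.
Qed.

(* Each round of the loop over tape [j] ends by moving the tapes of [d] by [m]; a second
   pass undoes these moves. *)
Definition sweep j (d : pred nat) (m m' : move) body :=
  Seq (For j (Seq body (mv_group d m))) (For j (mv_group d m')).

Lemma sweep_runs j d m m' body l c T (H : nat -> int) (row : nat -> seq tcell) w :
  j <= K -> ~~ g j -> ~~ d j -> (forall i, d i -> ~~ g i) ->
  move_int m' = (- move_int m)%R -> H j = 0 -> segment (T j) l ->
  (forall n w, n < l ->
     let Hn i := (if i == j then n%:Z else if d i then H i + n%:Z * move_int m else H i)%R in
     runs body (writing T Hn w) (writing T Hn (w ++ row n)) c) ->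
  runs (sweep j d m m' body) (writing T H w)
       (writing T H (w ++ flatten [seq row n | n <- iota 0 l])) (l * (c + 14) + 8).
Proof.
move=> jK /negbTE gj /negbTE dj dg mm Hj seg run_body.
(* [Hn] and [Hm] are the head positions in the first pass and in the second, which cancels the
   displacement of [d]. *)
pose Hn n i := (if i == j then n%:Z else if d i then H i + n%:Z * move_int m else H i)%R.
pose Hm n i := (if i == j then n%:Z
  else if d i then H i + l%:Z * move_int m - n%:Z * move_int m else H i)%R.
pose rows n := w ++ flatten [seq row n | n <- iota 0 n].
have dgF i : d i -> g i = false by move/dg/negbTE.
have first_pass : runs (For j (Seq body (mv_group d m))) (writing T (Hn 0) (rows 0))
    (writing T (Hm 0) (rows l)) (l * (c + 7) + 4).
  have -> : writing T (Hm 0) (rows l) = displace (pred1 j) (- l%:Z)%R (writing T (Hn l) (rows l)).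
    apply: store_eq => //= i; rewrite /Hm /Hn.
    have [->|nj] := eqVneq i j; first by rewrite gj; lia.
    by case: ifP => // _; case: ifP => // _; rewrite mul0r subr0.
  rewrite -[7]/(1 + 6) addnA.
  apply: (@for_runs _ _ l (c + 1) (fun n => writing T (Hn n) (rows n))
    (fun n => displace d (move_int m) (writing T (Hn n) (rows n.+1)))) => //.
  - by move=> n nl /=; rewrite gj /Hn eqxx.
  - move=> n nl; apply: runs_seq (mv_group_runs _ _ _).
    have := run_body n (rows n) nl.
    by rewrite /rows -addn1 iotaD map_cat flatten_cat /= cats0 catA.
  - move=> n nl; apply: store_eq => //= i; rewrite /Hn.
    have [->|nj] := eqVneq i j; first by rewrite dj gj; lia.
    case di: (d i); last by case: ifP.
    by rewrite dgF // -[n.+1]addn1 PoszD mulrDl mul1r addrA.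
have second_pass : runs (For j (mv_group d m')) (writing T (Hm 0) (rows l))
    (writing T H (rows l)) (l * 7 + 4).
  have -> : writing T H (rows l) = displace (pred1 j) (- l%:Z)%R (writing T (Hm l) (rows l)).
    apply: store_eq => //= i; rewrite /Hm.
    have [->|nj] := eqVneq i j; first by rewrite gj Hj; lia.
    by case: ifP => // _; case: ifP => // _; rewrite addrK.
  rewrite -[7]/(1 + 6).
  apply: (@for_runs _ _ l 1 (fun n => writing T (Hm n) (rows l))
    (fun n => displace d (move_int m') (writing T (Hm n) (rows l)))) => //.
  - by move=> n nl /=; rewrite gj /Hm eqxx.
  - by move=> n nl; apply: mv_group_runs.
  - move=> n nl; apply: store_eq => //= i; rewrite /Hm.
    have [->|nj] := eqVneq i j; first by rewrite dj gj; lia.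
    case di: (d i); last by case: ifP.
    by rewrite dgF // mm -[n.+1]addn1 PoszD; ring.
have -> : writing T H w = writing T (Hn 0) (rows 0).
  rewrite /rows /= cats0; apply: store_eq => //= i; rewrite /Hn.
  have [->|nj] := eqVneq i j; first by rewrite Hj.
  by rewrite mul0r addr0 if_same.
by apply: runs_le (runs_seq first_pass second_pass); lia.
Qed.

Definition landed T (H : nat -> int) w : store :=
  Store (fun i => if g i then 0%R else H i) (fun i => if g i then cells_tape w else T i).

Lemma land_runs j T H w : g j -> all isSome w ->
  runs (back g j) (writing T H w) (landed T H w) (3 * size w + 3).
Proof.
move=> gj aw.
have -> : landed T H w = displace g (- (size w)%:Z)%R (writing T H w).
  by apply: store_eq => //= i; case: ifP => // _; lia.
apply: (@back_runs _ _ _ (size w)) => //=; rewrite ?gj ?gK //.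
exact: cells_tape_segment.
Qed.

End Writing.
End Loops.

(** * Writing the adjacency matrix in polynomial time *)

Section PolynomialBounds.

Definition poly_fun (f : nat -> nat) := exists p : {poly nat}, forall n, f n = p.[n]%R.

Lemma poly_fun_const c : poly_fun (fun _ => c).
Proof. by exists (c%:P)%R => n; rewrite hornerC. Qed.

Lemma poly_fun_id : poly_fun id.
Proof. by exists ('X)%R => n; rewrite hornerX. Qed.

Lemma poly_fun_add f g : poly_fun f -> poly_fun g -> poly_fun (fun n => f n + g n).
Proof. by move=> [p pE] [q qE]; exists (p + q)%R => n; rewrite hornerD pE qE. Qed.

Lemma poly_fun_mul f g : poly_fun f -> poly_fun g -> poly_fun (fun n => f n * g n).
Proof. by move=> [p pE] [q qE]; exists (p * q)%R => n; rewrite hornerM pE qE. Qed.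

Lemma horner_nat_le (p : {poly nat}) m n : m <= n -> p.[m]%R <= p.[n]%R.
Proof.
move=> mn; rewrite /horner; elim: (polyseq p) => //= a s IH.
by rewrite leq_add2r leq_mul.
Qed.

(** A polynomial is given by its coefficient list, on which the program [rep] recurses. *)
Definition horner_seq (l : seq nat) n := foldr (fun a v => a + n * v) 0 l.

Lemma horner_seqE (p : {poly nat}) n : horner_seq p n = p.[n]%R.
Proof.
rewrite /horner /horner_seq; elim: (polyseq p) => //= a s ->.
by rewrite addnC mulnC.
Qed.

Lemma poly_fun_horner l : poly_fun (horner_seq l).
Proof.
elim: l => [|a l IH]; first exact: poly_fun_const.
apply: poly_fun_add; first exact: poly_fun_const.
by apply: poly_fun_mul IH; apply: poly_fun_id.
Qed.

End PolynomialBounds.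

(* Tape 0 holds the input; tapes 1-4 hold the ruler, their heads being the coordinates
   (t, p) and (t', p') of the row and of the column of the current matrix entry; the heads of
   tapes 5 and 6 are at t' - t and p' - p; the tapes from 7 on are copies of the input that
   serve as counters of nested loops; tape [K] is the output. *)
Section Construction.
Variables (qs bs : seq nat) (A : Type) (ks : seq A).
Local Notation tcell := (cell 'I_5).
Variable bitf : tcell -> tcell -> tcell -> tcell -> tcell -> tcell -> A -> A -> bool.

(** There is one counter for each level of Horner's scheme; the extra one ensures that tape 7, used
    to rewind the copies, exists. *)
Let d := (maxn (size qs) (size bs)).+1.
Let K := 7 + d.
Let gL : pred nat := fun i => (7 <= i) && (i < 7 + d).
Let gC : pred nat := fun i => (1 <= i) && (i <= 4).
Let gO : pred nat := pred1 K.

Local Notation run_prog := (@runs K 'I_5).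
Local Notation still := (fun i : nat => false).
Local Notation loop j body := (sweep j still Stay Stay body).

Lemma loop_runs (g : pred nat) j body l c T (H : nat -> int)
    (row : nat -> seq tcell) w :
  j <= K -> ~~ g j -> H j = 0%R -> segment (T j) l ->
  (forall n w, n < l -> let Hn i := (if i == j then n%:Z else H i)%R in
     run_prog body (writing g T Hn w) (writing g T Hn (w ++ row n)) c) ->
  run_prog (loop j body) (writing g T H w)
    (writing g T H (w ++ flatten [seq row n | n <- iota 0 l])) (l * (c + 14) + 8).
Proof. by move=> jK gj Hj seg run_body; apply: sweep_runs. Qed.

(* Writes [horner_seq l n] copies of [c], by Horner's scheme. *)
Fixpoint rep (l : seq nat) k (c : tcell) : prog 'I_5 :=
  if l is a :: l' then
    Seq (seqs [seq emit gC f | f <- nseq a (fun _ => c)]) (loop (7 + k) (rep l' k.+1 c))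
  else Nop _.

Fixpoint rep_cost (l : seq nat) n :=
  if l is a :: l' then a + (n * (rep_cost l' n + 14) + 8) else 0.

Lemma gC_K i : gC i -> i <= K.
Proof. by rewrite /gC /K; lia. Qed.

Lemma flatten_nseq (T : Type) (c : T) v l : flatten [seq nseq v c | n <- iota 0 l] = nseq (l * v) c.
Proof. by elim: l 0 => //= l IH m; rewrite IH mulSn nseqD. Qed.

Lemma rep_runs l k c T (H : nat -> int) w n : k + size l <= d ->
  (forall k', k <= k' < d -> H (7 + k') = 0%R /\ segment (T (7 + k')) n) ->
  run_prog (rep l k c) (writing gC T H w) (writing gC T H (w ++ nseq (horner_seq l n) c))
    (rep_cost l n).
Proof.
elim: l k H w => [|a l IH] k H w kd HT; first by rewrite cats0; apply: runs_nop.
rewrite /= nseqD catA; apply: runs_seq.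
  have := emits_runs gC_K (nseq a (fun _ => c)) T H w.
  by rewrite [X in writing _ _ _ (_ ++ X)]map_nseq size_nseq; apply.
rewrite -flatten_nseq; have [H0 seg] := HT k ltac:(rewrite /= in kd; lia).
apply: loop_runs => //; first by rewrite /K /= in kd *; lia.
move=> i w' il Hn; apply: IH; first by rewrite /= in kd; lia.
move=> k' kk; rewrite /Hn eqn_add2l ifF; last by lia.
by apply: HT; lia.
Qed.

Definition copy_input : prog 'I_5 := Seq (loop 0 (emit gL (fun r => r 0))) (back _ gL 7).

Definition write_ruler : prog 'I_5 := seqs
  [:: emit gC (fun _ => Fst); rep bs 0 Blk; emit gC (fun _ => Org);
      loop 0 (seqs [seq emit gC f | f <- [:: fun _ => Bit true; fun r => r 0]]);
      emit gC (fun _ => Bit false); rep qs 0 Gss; rep bs 0 Blk; emit gC (fun _ => Lst);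
      back _ gC 1].

Let gD : pred nat := fun i => (i == 5) || (i == 6).
Definition put (c : tcell) (m : move) : prog 'I_5 :=
  Act (fun r : nat -> tcell => (fun i => if gD i then c else r i,
                                fun i => if gD i then m else Stay)).

Definition write_marks : prog 'I_5 :=
  seqs [:: put Nul Rgt; put Pos Lft; mv_group _ gD Lft; put Neg Rgt].

Definition write_header : prog 'I_5 := Seq
  (loop 1 (loop 2 (seqs [seq emit gO f | f <- nseq (size ks) (fun _ => Bit true)])))
  (emit gO (fun _ => Bit false)).

Definition bit_prog k k' : prog 'I_5 :=
  emit gO (fun r => Bit (bitf (r 1) (r 2) (r 3) (r 4) (r 5) (r 6) k k')).

(** The loops are nested in the order in which vertices are enumerated. Row loops move the mark
    tapes left and column loops move them right, so that the heads stand at the differences. *)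
Definition write_matrix : prog 'I_5 :=
  sweep 1 (pred1 5) Lft Rgt (sweep 2 (pred1 6) Lft Rgt (seqs [seq
    sweep 3 (pred1 5) Rgt Lft (sweep 4 (pred1 6) Rgt Lft (seqs [seq bit_prog k k' | k' <- ks]))
  | k <- ks])).

Definition main_prog : prog 'I_5 :=
  seqs [:: copy_input; write_ruler; write_marks; write_header; write_matrix].

Section Input.
Variable x : word.
Let n := size x.
Let X : seq tcell := [seq Bit b | b <- x].
Let Q := horner_seq qs n.
Let B := horner_seq bs n.
Let R := ruler x Q B.
Let W := width x Q B.

Let none : int -> tcell := fun _ => None.
(** [T0] is the initial content of the tapes; [T1], [T2] and [T3] are those after the copies, the
    ruler and the marks. *)
Let T0 i := if i == 0 then cells_tape X else none.
Let T1 i := if gL i then cells_tape X else T0 i.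
Let T2 i := if gC i then cells_tape R else T1 i.
Let T3 i := if gD i then dmark else T2 i.
Let H0 (_ : nat) : int := 0%R.

Lemma cells_tape_nil (z : int) : cells_tape [::] z = None :> tcell.
Proof. by case: z => // k; rewrite /= nth_nil. Qed.

Lemma segment_X : segment (cells_tape X) n.
Proof.
rewrite -[n](size_map (fun b => Bit b : tcell)); apply: cells_tape_segment.
by rewrite all_map; apply/allP.
Qed.

Lemma size_R : size R = W. Proof. by []. Qed.

Lemma all_R : all isSome R.
Proof.
rewrite /R /ruler /ruler_tail /= all_cat /= !all_cat !all_nseq /= all_map !orbT /= !andbT.
exact/allP.
Qed.

Lemma gL_K i : gL i -> i <= K. Proof. by rewrite /gL /K; lia. Qed.

Definition copy_cost := n * (1 + 14) + 8 + (3 * n + 3).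

Lemma copy_input_runs : run_prog copy_input (Store H0 T0) (Store H0 T1) copy_cost.
Proof.
have gL7 : gL 7 by [].
have -> : Store H0 T0 = writing gL T0 H0 [::].
  apply: store_eq => [i|i z] /=; first by case: ifP.
  by case: ifP => // gi; rewrite cells_tape_nil /T0; case: i gi.
have -> : Store H0 T1 = landed gL T0 H0 X.
  by apply: store_eq => [i|i z] /=; rewrite ?/T1; case: (gL i).
rewrite /copy_cost {2}(_ : n = size X); last by rewrite size_map.
apply: runs_seq (land_runs gL_K _ _ gL7 _); last by rewrite all_map; apply/allP.
rewrite {1}(_ : X = [::] ++ flatten [seq [:: nth None X i] | i <- iota 0 n]).
  apply: loop_runs => //; first exact: segment_X.
  move=> i w il Hn; rewrite cats1.
  have := emit_runs gL_K (fun r => r 0) T0 Hn w; by rewrite /read /Hn.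
rewrite /= [flatten _]flatten_map1; apply/esym.
by rewrite -[RHS](mkseq_nth None) /mkseq size_map.
Qed.

Definition ruler_cost :=
  1 + (rep_cost bs n + (1 + ((n * (2 + 14) + 8) +
    (1 + (rep_cost qs n + (rep_cost bs n + (1 + (3 * W + 3 + 0)))))))).

Lemma flatten_pairs : flatten [seq [:: Bit true; nth None X i] | i <- iota 0 n] ++ [:: Bit false] =
  [seq Bit b | b <- prefix_word x] :> seq tcell.
Proof.
rewrite /prefix_word /pair_word map_cat /=; congr (_ ++ _); rewrite /X /n.
elim: x => //= b s IH; congr [:: _, _ & _]; rewrite -IH -[1]/(1 + 0) iotaDl -map_comp.
by congr flatten; apply: eq_map.
Qed.

Lemma write_ruler_runs : run_prog write_ruler (Store H0 T1) (Store H0 T2) ruler_cost.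
Proof.
have -> : Store H0 T1 = writing gC T1 H0 [::].
  apply: store_eq => [i|i z] /=; first by case: ifP.
  case: ifP => // gi; rewrite cells_tape_nil /T1 /T0.
  by move: gi; rewrite /gC; case: i => [|[|[|[|[|]]]]].
have -> : Store H0 T2 = landed gC T1 H0 R.
  by apply: store_eq => [i|i z] /=; rewrite ?/T2; case: (gC i).
have segL k : 0 <= k < d -> H0 (7 + k) = 0%R /\ segment (T1 (7 + k)) n.
  by move=> kd; split=> //; rewrite /T1 /gL ifT; [apply: segment_X | lia].
have emitC c w : run_prog (emit gC (fun _ => c)) (writing gC T1 H0 w)
    (writing gC T1 H0 (rcons w c)) 1.
  by apply: (emit_runs gC_K (fun _ => c)).
have repC l c w : size l <= d -> run_prog (rep l 0 c) (writing gC T1 H0 w)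
    (writing gC T1 H0 (w ++ nseq (horner_seq l n) c)) (rep_cost l n).
  by move=> ld; apply: rep_runs.
have szb : size bs <= d by rewrite /d; lia.
have szq : size qs <= d by rewrite /d; lia.
apply: runs_seq (emitC _ _) _; apply: runs_seq (repC _ _ _ szb) _.
apply: runs_seq (emitC _ _) _.
apply: runs_seq.
  apply: (loop_runs (row := fun i => [:: Bit true; nth None X i])) => //; first exact: segment_X.
  move=> i w il Hn.
  exact: (emits_runs gC_K [:: fun _ => Bit true; fun r => r 0] T1 Hn w).
apply: runs_seq (emitC _ _) _; apply: runs_seq (repC _ _ _ szq) _.
apply: runs_seq (repC _ _ _ szb) _; apply: runs_seq (emitC _ _) _.
apply: runs_seq (runs_nop _ _).
set w := rcons _ Lst; have -> : w = R.
  rewrite /w /R /ruler /ruler_tail -flatten_pairs /= -!cats1 /=.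
  by rewrite -!catA /=; congr (_ :: _ ++ _ :: _); rewrite -!catA.
rewrite -size_R; apply: (land_runs gC_K _ _ _ all_R); by [].
Qed.

Lemma write_marks_runs : run_prog write_marks (Store H0 T2) (Store H0 T3) 4.
Proof.
pose at_head (h : int) T := Store (fun i => if gD i then h else 0%R) T : store 'I_5.
have put_runs c m h T : run_prog (put c m) (at_head h T)
    (at_head (moved m h) (fun i z => if gD i && (z == h) then c else T i z)) 1.
  exists 1 => //; rewrite (_ : at_head (moved m h) _ = perform K (fun r : nat -> tcell =>
    (fun i => if gD i then c else r i, fun i => if gD i then m else Stay)) (at_head h T)).
    exact: ExecAct.
  apply: store_eq => [i|i z] /=; first by case: (gD i).
  rewrite /scanned /=; case gi: (gD i) => /=.
    have -> : i <= K by move: gi; rewrite /gD /K; lia.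
    by case: eqP.
  by case: leqP => //= _; case: eqP => [->|].
have mv_runs m h T : run_prog (mv_group _ gD m) (at_head h T) (at_head (h + move_int m)%R T) 1.
  apply: runs_eq (mv_group_runs _ _ _ _) _.
  by apply: store_eq => //= i; case: (gD i).
have -> : Store H0 T2 = at_head 0%R T2 by apply: store_eq => //= i; rewrite if_same.
apply: runs_eq (runs_seq (put_runs Nul Rgt _ _) (runs_seq (put_runs Pos Lft _ _)
  (runs_seq (mv_runs Lft _ _) (runs_seq (put_runs Neg Rgt _ _) (runs_nop K _))))) _.
apply: store_eq => [i|i z] /=; first by case: (gD i).
rewrite /T3; case gi: (gD i) => //=.
have T2i : T2 i z = None.
  rewrite /T2 /T1 /T0 /gC /gL; move: gi; rewrite /gD.
  by case: i => [|[|[|[|[|[|[|]]]]]]].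
by rewrite T2i /dmark; do ! case: eqP => //; lia.
Qed.

Lemma gO_K i : gO i -> i <= K. Proof. by move/eqP->. Qed.

Lemma segment_R : segment (cells_tape R) W.
Proof. by rewrite -size_R; apply: cells_tape_segment all_R. Qed.

Lemma T3_ruler i : 1 <= i <= 4 -> T3 i = cells_tape R.
Proof. by case: i => [|[|[|[|[|]]]]]. Qed.

Definition header_cost := W * (W * (size ks + 14) + 8 + 14) + 8 + 1.

Definition header : seq tcell := nseq (W * (W * size ks)) (Bit true) ++ [:: Bit false].

Lemma write_header_runs :
  run_prog write_header (writing gO T3 H0 [::]) (writing gO T3 H0 header) header_cost.
Proof.
rewrite /header cats1; apply: runs_seq; last exact: (emit_runs gO_K (fun _ => Bit false) T3 H0).
rewrite -[nseq _ _]cat0s -flatten_nseq.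
apply: loop_runs => //; first by rewrite T3_ruler //; apply: segment_R.
move=> i w il Hn; rewrite -flatten_nseq.
apply: loop_runs => //; first by rewrite T3_ruler //; apply: segment_R.
move=> j w' jl Hn'.
have := emits_runs gO_K (nseq (size ks) (fun _ => Bit true)) T3 Hn' w'.
by rewrite [X in writing _ _ _ (_ ++ X)]map_nseq size_nseq.
Qed.

Definition matrix_cost :=
  W * (W * (size ks * (W * (W * (size ks * 1 + 14) + 8 + 14) + 8) + 14) + 8 + 14) + 8.

Definition bit_row t p k t' p' : seq tcell :=
  [seq Bit (bitf (nth None R t) (nth None R p) (nth None R t') (nth None R p')
    (dmark (t'%:Z - t%:Z)%R) (dmark (p'%:Z - p%:Z)%R) k k') | k' <- ks].

Definition matrix_word : seq tcell :=
  flatten [seq flatten [seq flatten [seq flatten [seq flatten [seq bit_row t p k t' p'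
    | p' <- iota 0 W] | t' <- iota 0 W] | k <- ks] | p <- iota 0 W] | t <- iota 0 W].

Lemma write_matrix_runs w :
  run_prog write_matrix (writing gO T3 H0 w) (writing gO T3 H0 (w ++ matrix_word)) matrix_cost.
Proof.
have seg i : 1 <= i <= 4 -> segment (T3 i) W by move=> hi; rewrite T3_ruler //; apply: segment_R.
rewrite /write_matrix /matrix_word /matrix_cost.
apply: sweep_runs => //; [by move=> i /eqP -> | exact: seg |].
move=> t w1 tW H1; apply: sweep_runs => //; [by move=> i /eqP -> | exact: seg |].
move=> p w2 pW H2; apply: seqs_runs => k w3.
apply: sweep_runs => //; [by move=> i /eqP -> | exact: seg |].
move=> t' w4 tW' H3; apply: sweep_runs => //; [by move=> i /eqP -> | exact: seg |].
move=> p' w5 pW' H4.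
have e5 : H4 5 = (t'%:Z - t%:Z)%R by rewrite /H4 /H3 /H2 /H1 /H0 /= /move_int /=; lia.
have e6 : H4 6 = (p'%:Z - p%:Z)%R by rewrite /H4 /H3 /H2 /H1 /H0 /= /move_int /=; lia.
have := @seqs_runs K 'I_5 gO A ks (bit_prog k) (fun k' => [:: Bit (bitf (nth None R t)
  (nth None R p) (nth None R t') (nth None R p')
  (dmark (t'%:Z - t%:Z)%R) (dmark (p'%:Z - p%:Z)%R) k k')])
  T3 H4 w5 1.
rewrite [flatten _]flatten_map1; apply=> k' w6; rewrite cats1.
have := emit_runs gO_K (fun r => Bit (bitf (r 1) (r 2) (r 3) (r 4) (r 5) (r 6) k k')) T3 H4 w6.
by rewrite /read /= e5 e6.
Qed.

Definition main_cost := copy_cost + (ruler_cost + (4 + (header_cost + (matrix_cost + 0)))).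

Theorem main_prog_runs : exists s, run_prog main_prog (Store H0 T0) s main_cost /\
  tp s K = cells_tape (header ++ matrix_word).
Proof.
exists (writing gO T3 H0 (header ++ matrix_word)); split; last by rewrite /= ifT // /gO inE.
apply: runs_seq copy_input_runs _; apply: runs_seq write_ruler_runs _.
apply: runs_seq write_marks_runs _.
have -> : Store H0 T3 = writing gO T3 H0 [::].
  apply: store_eq => [i|i z] /=; first by case: ifP.
  case: ifP => // /eqP ->; rewrite cells_tape_nil /T3 /T2 /T1 /T0 /gL /gC /gD /K.
  by rewrite !ifF //; lia.
apply: runs_seq write_header_runs _.
exact: runs_seq (write_matrix_runs _) (runs_nop _ _).
Qed.

End Input.
End Construction.

Lemma outputs_within_le (M : machine) x y t t' : t <= t' ->
  outputs_within M x y t -> outputs_within M x y t'.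
Proof.
move=> /subnK <- [h o]; rewrite /outputs_within; suff -> : run M x (t' - t + t) = run M x t by [].
elim: (t' - t) => // n IH; rewrite addSn -[LHS]/(step (run M x (n + t))) IH.
by rewrite /step h.
Qed.

Lemma poly_time_prog K (p : prog 'I_5) (f : word -> word) (cost : nat -> nat) :
  poly_fun cost ->
  (forall x, exists s, @runs K 'I_5 p
     (Store (fun _ => 0%R)
        (fun i => if i == 0 then cells_tape [seq Bit b | b <- x] else fun _ => None))
     s (cost (size x)) /\ tp s K = cells_tape [seq Bit b | b <- f x]) ->
  poly_time f.
Proof.
case=> r rE run_p; exists (@code_machine K 'I_5 (compile 0 p)), r => x.
have [s [[n ln ex] out]] := run_p x; rewrite -rE; apply: outputs_within_le ln _.
have word_cells (w : word) z : word_tape 'I_5 w z = cells_tape [seq Bit b | b <- w] z.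
  case: z => //= k; elim: w k => [|b w IH] [|k] //=; by rewrite IH.
have run_n : run (@code_machine K 'I_5 (compile 0 p)) x n =
    code_config K (compile 0 p) (size (compile 0 p)) s.
  rewrite -(run_exec erefl ex) /run; congr iter; rewrite /initial /code_config.
  congr Config; first by apply: val_inj; rewrite /= inordK.
  apply: functional_extensionality => j; apply: functional_extensionality => z.
  by rewrite -[j == ord0]/(j == 0 :> nat) /=; case: eqP.
split; first by rewrite run_n; apply: code_halted.
by move=> z; rewrite run_n /= out word_cells.
Qed.

(** * Enumeration order of the vertices and graph encodings *)

Section Enumerations.

Lemma enum_prod (S T : finType) : enum {: S * T} = [seq (a, b) | a <- enum S, b <- enum T].
Proof. by rewrite [LHS]enumT unlock. Qed.

Lemma flatten_allpairs (S T A : Type) (F : S * T -> seq A) s t :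
  flatten [seq F z | z <- [seq (a, b) | a <- s, b <- t]] =
  flatten [seq flatten [seq F (a, b) | b <- t] | a <- s].
Proof. by elim: s => //= a s IH; rewrite map_cat flatten_cat IH -map_comp. Qed.

Lemma map_allpairs (S T A : Type) (F : S * T -> A) s t :
  [seq F z | z <- [seq (a, b) | a <- s, b <- t]] =
  flatten [seq [seq F (a, b) | b <- t] | a <- s].
Proof. by elim: s => //= a s IH; rewrite map_cat IH -map_comp. Qed.

Lemma map_enum_ord n (A : Type) (F : nat -> A) :
  [seq F (i : 'I_n) | i <- enum 'I_n] = [seq F i | i <- iota 0 n].
Proof. by rewrite -val_enum_ord -map_comp. Qed.

Lemma matrix_enum n (T : finType) (A : Type) (F : nat -> nat -> T -> nat -> nat -> T -> A) :
  flatten [seq [seq F (x.1.1 : 'I_n) (x.1.2 : 'I_n) x.2 (y.1.1 : 'I_n) (y.1.2 : 'I_n) y.2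
    | y <- enum {: 'I_n * 'I_n * T}] | x <- enum {: 'I_n * 'I_n * T}] =
  flatten [seq flatten [seq flatten [seq flatten [seq flatten [seq
    [seq F t p k t' p' k' | k' <- enum T]
    | p' <- iota 0 n] | t' <- iota 0 n] | k <- enum T] | p <- iota 0 n] | t <- iota 0 n].
Proof.
rewrite enum_prod flatten_allpairs enum_prod flatten_allpairs.
rewrite -(map_enum_ord n (fun t => flatten [seq flatten [seq flatten [seq flatten [seq
    [seq F t p k t' p' k' | k' <- enum T]
    | p' <- iota 0 n] | t' <- iota 0 n] | k <- enum T] | p <- iota 0 n])).
congr flatten; apply: eq_map => t.
rewrite -(map_enum_ord n (fun p => flatten [seq flatten [seq flatten [seq
    [seq F t p k t' p' k' | k' <- enum T]
    | p' <- iota 0 n] | t' <- iota 0 n] | k <- enum T])).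
congr flatten; apply: eq_map => p; congr flatten; apply: eq_map => k /=.
rewrite map_allpairs flatten_allpairs.
rewrite -(map_enum_ord n (fun t' => flatten [seq
    [seq F t p k t' p' k' | k' <- enum T] | p' <- iota 0 n])).
congr flatten; apply: eq_map => t'.
by rewrite -(map_enum_ord n (fun p' => [seq F t p k t' p' k' | k' <- enum T])).
Qed.

Lemma encode_cells (G : graph) : [seq Bit b | b <- encode_graph G] =
  (nseq #|G| (Bit true) ++ [:: Bit false]) ++
  flatten [seq [seq Bit (adj x y) | y <- enum G] | x <- enum G] :> seq (cell 'I_5).
Proof.
rewrite /encode_graph map_cat map_nseq -catA /=; congr (_ ++ _ :: _).
rewrite map_flatten -map_comp; congr flatten; apply: eq_map => x /=.
by rewrite -map_comp.
Qed.

End Enumerations.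

(** * The polynomial-time reduction *)

Section Reduction.
Variables (M : machine) (m : nat) (bs qs : seq nat).

Let rulerQ (x : word) := horner_seq qs (size x).
Let rulerB (x : word) := horner_seq bs (size x).
Let side_length x := width x (rulerQ x) (rulerB x).

Definition corner x : grid x (rulerQ x) (rulerB x) := (ord0, ord0).

Definition tableau_graph x : graph :=
  gadget m (corner x) (@grid_allowed M x (rulerQ x) (rulerB x))
    (@grid_overlap M x (rulerQ x) (rulerB x)).

Let kinds := enum (kind (window M) (site M) m).

(** Ruler labels and truncated differences determine adjacency, so a single transition can compute
    each bit; [dopp] supplies the reversed differences. *)
Definition tableau_bit (ct cp ct' cp' mt mp : cell 'I_5)
    (k k' : kind (window M) (site M) m) : bool :=
  let o := (ct == Fst) && (cp == Fst) in
  let o' := (ct' == Fst) && (cp' == Fst) in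
  let same := (mt == Nul) && (mp == Nul) in
  half_adj o o' same (allowed M ct cp) (allowed M ct' cp') (overlap M (dopp mt) (dopp mp)) k k' ||
  half_adj o' o same (allowed M ct' cp') (allowed M ct cp) (overlap M mt mp) k' k.

Lemma ruler_FstE x Q B p : (nth None (ruler x Q B) p == Fst) = (p == 0).
Proof. rewrite rulerE; do ! case: ifP => ?; rewrite ?mark_eqE //; lia. Qed.

Lemma dmark_NulE (p q : nat) : (dmark (q%:Z - p%:Z)%R == Nul) = (p == q).
Proof.
rewrite /dmark; have [e|_] := eqVneq (q%:Z - p%:Z)%R (-1)%R.
  by rewrite mark_eqE; apply/esym; lia.
have [e|ne] := eqVneq (q%:Z - p%:Z)%R 0%R; first by rewrite mark_eqE; lia.
by have [e|_] := eqVneq (q%:Z - p%:Z)%R 1%R; rewrite mark_eqE; lia.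
Qed.

Lemma tableau_adjE x (i j : grid x (rulerQ x) (rulerB x)) k k' :
  @adj (tableau_graph x) (i, k) (j, k') =
  let R := nth None (ruler x (rulerQ x) (rulerB x)) in
  tableau_bit (R i.1) (R i.2) (R j.1) (R j.2)
    (dmark ((j.1 : nat)%:Z - (i.1 : nat)%:Z)%R) (dmark ((j.2 : nat)%:Z - (i.2 : nat)%:Z)%R) k k'.
Proof.
rewrite gadget_adjE /tableau_bit.
have cornerE (l : grid x (rulerQ x) (rulerB x)) :
    (l == corner x) = (l.1 == 0 :> nat) && (l.2 == 0 :> nat).
  by case: l.
have sameE : (i == j) = (i.1 == j.1 :> nat) && (i.2 == j.2 :> nat) by case: (i) (j) => [? ?] [? ?].
rewrite -!dmarkN !opprB !ruler_FstE !dmark_NulE (eq_sym j i) sameE !cornerE.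
by congr (_ || _); congr half_adj.
Qed.

Lemma encode_tableau x :
  [seq Bit b | b <- encode_graph (tableau_graph x)] =
  @header qs bs _ kinds x ++ @matrix_word qs bs _ kinds tableau_bit x :> seq (cell 'I_5).
Proof.
rewrite encode_cells; congr ((_ ++ _) ++ _).
  by congr nseq; rewrite [LHS]card_prod [X in X * _]card_prod !card_ord -cardE mulnA.
pose R := nth None (ruler x (rulerQ x) (rulerB x)).
rewrite /matrix_word -/(rulerQ x) -/(rulerB x) -/(side_length x).
rewrite -(@matrix_enum (side_length x) _ _ (fun t p k t' p' k' =>
  Bit (tableau_bit (R t) (R p) (R t') (R p')
  (dmark (t'%:Z - t%:Z)%R) (dmark (p'%:Z - p%:Z)%R) k k'))).
congr flatten; apply: eq_map => -[i k]; apply: eq_map => -[j k'].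
by rewrite tableau_adjE.
Qed.

Definition length_fun n :=
  horner_seq bs n + 2 + (2 * n + 1) + horner_seq qs n + horner_seq bs n + 1.

Lemma poly_fun_rep l : poly_fun (rep_cost l).
Proof.
elim: l => [|a l IH] /=; first exact: poly_fun_const.
do ! first [exact: poly_fun_const | exact: poly_fun_id | exact: IH
  | apply: poly_fun_add | apply: poly_fun_mul].
Qed.

Lemma poly_fun_length : poly_fun length_fun.
Proof.
do ! first [exact: poly_fun_const | exact: poly_fun_id | exact: poly_fun_horner
  | apply: poly_fun_add | apply: poly_fun_mul].
Qed.

Lemma tableau_poly_time : poly_time (fun x => encode_graph (tableau_graph x)).
Proof.
pose W := length_fun; pose z := size kinds.
pose cost n := (n * (1 + 14) + 8 + (3 * n + 3)) +
  ((1 + (rep_cost bs n + (1 + ((n * (2 + 14) + 8) +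
    (1 + (rep_cost qs n + (rep_cost bs n + (1 + (3 * W n + 3 + 0))))))))) +
  (4 + ((W n * (W n * (z + 14) + 8 + 14) + 8 + 1) +
  (W n * (W n * (z * (W n * (W n * (z * 1 + 14) + 8 + 14) + 8) + 14) + 8 + 14) + 8 + 0)))).
have pW : poly_fun W by exact: poly_fun_length.
have pcost : poly_fun cost.
  do ! first [exact: poly_fun_const | exact: poly_fun_id | exact: poly_fun_rep | exact: pW
    | apply: poly_fun_add | apply: poly_fun_mul].
apply: (@poly_time_prog (7 + (maxn (size qs) (size bs)).+1)
  (main_prog qs bs kinds tableau_bit) _ _ pcost) => x.
have [s [rs out]] := main_prog_runs qs bs kinds tableau_bit x.
exists s; split; last by rewrite out encode_tableau.
apply: runs_le rs; rewrite /main_cost /copy_cost /ruler_cost /header_cost /matrix_cost.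
rewrite /cost (_ : W (size x) = width x (horner_seq qs (size x)) (horner_seq bs (size x))) //.
by rewrite /W /length_fun widthE size_prefix_word.
Qed.

End Reduction.

Lemma coNP_reduction (m : nat) (L : language) : coNP L ->
  exists G : word -> graph,
    [/\ poly_time (fun x => encode_graph (G x)), forall x, colorable m.+3 (G x),
        forall x, singletons_but_two m.+2 (G x) & forall x, L x <-> k_mixing m.+3 (G x)].
Proof.
case=> V [q [[M [r V_time]] LE]].
(* The verifier runs on pairs of length [2|x| + 1 + |w|], where [|w|] is at most [q] at [|x|]. *)
pose b : {poly nat} := (r \Po (2%:P * 'X + 1 + q))%R.
exists (tableau_graph M m b q); split.
- exact: tableau_poly_time.
- by move=> x; apply: gadget_colorable.
- by move=> x; apply: gadget_singletons.
move=> x; rewrite gadget_mixing.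
have bound w : size w <= horner_seq q (size x) ->
    outputs_within M (pair_word x w) (V (pair_word x w)) (horner_seq b (size x)).
  move=> sw; apply: outputs_within_le (V_time _); rewrite horner_seqE /b horner_comp.
  apply: horner_nat_le; rewrite pair_wordE size_cat size_prefix_word.
  rewrite !hornerD hornerM !hornerC hornerX.
  by rewrite -horner_seqE leq_add.
have satE : sat (@grid_allowed M x (horner_seq q (size x)) (horner_seq b (size x)))
    (@grid_overlap M x (horner_seq q (size x)) (horner_seq b (size x))) <-> ~ L x.
  rewrite LE; split=> [/(sat_run bound)[w sw acc]|[w [sw acc]]].
    by exists w; rewrite -horner_seqE.
  by rewrite -horner_seqE in sw; apply: run_sat bound _ sw acc.
rewrite satE; split=> [Lx nLx //|]; exact: NNPP.
Qed.

Theorem theorem2 (k : nat) (hk : 4 <= k) :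
  coNP_hard (Mixing k) /\
  coNP_hard (@restrict (Mixing k)
    (fun G : {G : graph | colorable k G} =>
       singletons_but_two (k - 1) (proj1_sig G))).
Proof.
have -> : k = (k - 3).+3 by lia.
rewrite (_ : (k - 3).+3 - 1 = (k - 3).+2); last by lia.
split=> L /(@coNP_reduction (k - 3))[G [poly col sing mix]].
  by exists (fun x => exist _ (G x) (col x)).
by exists (fun x => exist _ (exist _ (G x) (col x)) (sing x)).
Qed.
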